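(* Let $A$ be a truncated bi-Koszul algebra determined by $\varDelta_d$ with $d\ge4$, and let $E=E(A)$ be its $A_\infty$-Ext-algebra $(E;m_2,m_d,m_{d+1})$. Set $$F:=E^{[0]}\oplus E^{[1]}\oplus E^{[2]}_{(d)},\qquad G:=E^{[0]}\oplus E^{[1]}\oplus E^{[2]}_{(d+1)}.$$ Then: (1) $(F;m_2,m_d)$ is a pure and single $A_\infty$-subalgebra of $(E;m_2,m_d)$, where $m_d$ (on $F$) is determined by $m_2$ and $m_d|_{(E^1)^{\otimes d}}$; (2) $(G;m_2,m_{d+1})$ is a pure and single $A_\infty$-subalgebra of $(E;m_2,m_{d+1})$, where $m_{d+1}$ (on $G$) is determined by $m_2$ and $m_{d+1}|_{(E^1)^{\otimes (d+1)}}$.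
   Context: Fix a field $\mathbb F$. All graded algebras $A=\mathbb F\oplus A_1\oplus A_2\oplus\cdots$ are locally finite, connected and generated in degree 1; $\mathbb F$ also denotes the trivial graded left module $A/A_{\ge 1}$. Put $E(A)=\bigoplus_{p,j}E^p_j(A)$ with $E^p_j(A)=\underline{\mathrm{Ext}}^p_A(\mathbb F,\mathbb F)_{-j}$, where $\underline{\mathrm{Ext}}$ is the derived functor of $\underline{\mathrm{Hom}}_A(M,N)=\bigoplus_n\mathrm{Hom}_{Gr(A)}(M,N[n])$ (degree-zero graded maps, $N[n]_j=N_{n+j}$); $p$ is the cohomological degree and $j$ the lower grading; $E^p(A)=\bigoplus_j E^p_j(A)$. For $d\ge2$ let $\varDelta_d(3k)=(2dk,2dk)$, $\varDelta_d(3k+1)=(2dk+1,2dk+1)$, $\varDelta_d(3k+2)=(2dk+d,2dk+d+1)$ for $k\ge 0$. $A$ is a bi-Koszul algebra determined by $\varDelta_d$ if the trivial module $\mathbb F$ has a minimal graded free resolution $P$ in which $P_n$ is generated in degrees $\varDelta_d(n)$ (the pair viewed as a set) for all $n\ge0$. An $A_\infty$-algebra is a $\mathbb Z$-graded vector space $E$ with linear maps $m_n:E^{\otimes n}\to E$ of degree $2-n$ ($n\ge1$) such that for all $n\ge1$, $\sum(-1)^{i+jt}m_{i+1+j}(1^{\otimes i}\otimes m_t\otimes 1^{\otimes j})=0$, the sum over $n=i+t+j$, $i,j\ge0$, $t\ge1$. All $A_\infty$-algebras are strictly unital ($1\in E$ is a two-sided unit for $m_2$, and $m_n(x_1,\dots,x_n)=0$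 for $n\ne2$ if some $x_i=1$). Writing $(E;m_a,m_b,\dots)$ means that all multiplications not listed are zero. An $A_\infty$-subalgebra is a graded subspace closed under all $m_n$. An $A_\infty$-Ext-algebra structure on $E(A)$ is one obtained by the minimality theorem (Kadeishvili) from the differential graded algebra $\mathrm{End}_A(P)$, $P$ a free resolution of ${}_A\mathbb F$: thus $m_1=0$, $m_2$ is the Yoneda product, every $m_n$ preserves the lower grading, and $E(A)$ is quasi-isomorphic to $\mathrm{End}_A(P)$. Notation: $E^{[r]}=\bigoplus_{k\ge0}E^{3k+r}$ for $r=0,1,2$; $E^{[2]}_{(d)}=\bigoplus_k E^{3k+2}_{2dk+d}$, $E^{[2]}_{(d+1)}=\bigoplus_kE^{3k+2}_{2dk+d+1}$, so $E^{[2]}=E^{[2]}_{(d)}\oplus E^{[2]}_{(d+1)}$. Truncated: a bi-Koszul algebra $A$ determined by $\varDelta_d$ is truncated if its $A_\infty$-Ext-algebra $E$ only has the non-trivial multiplications $m_2,m_d,m_{d+1}$, and these vanish on tensor products of the pieces $E^{[0]}$, $E^{[1]}$, $E^{[2]}_{(d)}$, $E^{[2]}_{(d+1)}$ except possibly on the following (all permutations of factors included), with values in the indicated piece: $m_2$: $E^{[0]}E^{[0]}\to E^{[0]}$; $E^{[0]}E^{[1]}$ and $E^{[2]}_{(d)}E^{[2]}_{(d+1)}\to E^{[1]}$; $E^{[0]}E^{[2]}\to E^{[2]}$. $m_d$: ($d-1$ factors $E^{[1]}$, one factor $E^{[2]}_{(d+1)}$) $\to E^{[0]}$; ($d$ factors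 $E^{[1]}$) $\to E^{[2]}$. $m_{d+1}$: ($d$ factors $E^{[1]}$, one factor $E^{[2]}_{(d)}$) $\to E^{[0]}$; ($d+1$ factors $E^{[1]}$) $\to E^{[2]}$. Single: an $A_\infty$-algebra with $m_1=0$ and only one non-trivial higher multiplication $m_p$ ($p\ge3$), i.e. $m_n=0$ for $n\notin\{2,p\}$ (a $(2,p)$-algebra). Pure: a bigraded minimal ($m_1=0$) $A_\infty$-algebra is pure if each component of given cohomological degree is supported in a single lower grading. ''Determined'' (with $t=d$, $H=F$ or $t=d+1$, $H=G$): if $m_t':H^{\otimes t}\to H$ is a graded map of degree $2-t$ preserving the lower grading, vanishing on tensor products of the pieces other than $(E^{[1]})^{\otimes t}$, such that $(H;m_2,m_t')$ is an $A_\infty$-algebra and $m_t'=m_t$ on $(E^1)^{\otimes t}$, then $m_t'=m_t$ on $H^{\otimes t}$. *)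

(* Defs.v *)
From HB Require Import structures.
From mathcomp Require Import all_boot all_order all_algebra.

Set Implicit Arguments.
Unset Strict Implicit.
Unset Printing Implicit Defensive.

Import GRing.Theory.
Local Open Scope ring_scope.

(** Graded objects are represented internally: one carrier together with a
    family of (Prop-valued) subspaces whose direct sum is the carrier.  A graded
    subspace [H] of the carrier is again a predicate, and every notion below that
    has to make sense on such a subspace takes [H] as an argument. *)

Definition whole (V : Type) : V -> Prop := fun _ => True.

Definition all_in (V : eqType) (H : V -> Prop) (xs : seq V) : Prop :=
  forall x, x \in xs -> H x.

Fixpoint homs (I V : Type) (gr : I -> V -> Prop) (ps : seq I) (xs : seq V) :
    Prop :=
  match ps, xs with
  | [::], [::] => True
  | p :: ps', x :: xs' => gr p x /\ homs gr ps' xs'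
  | _, _ => False
  end.

Definition subgroup (V : zmodType) (H : V -> Prop) : Prop :=
  H 0 /\ forall x y, H x -> H y -> H (x - y).

(** [H] is the internal direct sum of the subgroups [H :&: gr i]. *)
Definition internal_grading (I : eqType) (V : zmodType) (H : V -> Prop)
    (gr : I -> V -> Prop) : Prop :=
  [/\ subgroup H,
      (forall i, subgroup (gr i)),
      (forall x, H x -> exists (s : seq I) (f : I -> V),
          (forall i, H (f i) /\ gr i (f i)) /\ x = \sum_(i <- s) f i)
    & (forall (s : seq I) (f : I -> V), uniq s ->
          (forall i, H (f i) /\ gr i (f i)) -> \sum_(i <- s) f i = 0 ->
          forall i, i \in s -> f i = 0)].

Definition graded_space (K : fieldType) (I : eqType) (V : lmodType K)
    (H : V -> Prop) (gr : I -> V -> Prop) : Prop :=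
  [/\ internal_grading H gr,
      (forall a x, H x -> H (a *: x))
    & (forall i a x, gr i x -> gr i (a *: x))].

Definition lin_span (R : pzRingType) (V : lmodType R) (S : V -> Prop) (x : V) :
    Prop :=
  exists (r : nat) (a : 'I_r -> R) (y : 'I_r -> V),
    (forall l, S (y l)) /\ x = \sum_(l < r) a l *: y l.

(** The direct sum of the pieces [gr i] with [S i]. *)
Definition hsum (I : eqType) (V : zmodType) (gr : I -> V -> Prop)
    (S : I -> Prop) (x : V) : Prop :=
  exists (s : seq I) (f : I -> V),
    [/\ (forall i, gr i (f i)), (forall i, i \in s -> S i)
      & x = \sum_(i <- s) f i].

Definition ksign (R : pzRingType) (z : int) : R := (-1) ^+ `|z|%N.

(** * Graded algebras: locally finite, connected, generated in degree 1 *)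

Record gradedAlgebra (K : fieldType) := GradedAlgebra {
  galg :> algType K;
  ga_gr : nat -> galg -> Prop;
  ga_graded : graded_space (@whole galg) ga_gr;
  ga_mul : forall i j a b, ga_gr i a -> ga_gr j b -> ga_gr (i + j)%N (a * b);
  ga_connected : forall a, ga_gr 0 a <-> exists c : K, a = c%:A;
  ga_locally_finite : forall i, exists (r : nat) (b : 'I_r -> galg),
    (forall l, ga_gr i (b l)) /\
    (forall a, ga_gr i a -> exists c : 'I_r -> K, a = \sum_(l < r) c l *: b l);
  ga_gen1 : forall S : galg -> Prop,
    S 1 ->
    (forall (c : K) a b, S a -> S b -> S (c *: a + b)) ->
    (forall a b, S a -> S b -> S (a * b)) ->
    (forall a, ga_gr 1 a -> S a) ->
    forall a, S a
}.

(** * Graded free resolutions of the trivial module *)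

Section Resolutions.
Variables (K : fieldType) (A : gradedAlgebra K).

(** A-linear maps to the trivial left module [K = A / A_{>=1}]. *)
Definition triv_linear (P : lmodType A) (phi : P -> K) : Prop :=
  [/\ (forall x y, phi (x + y) = phi x + phi y),
      (forall (c : K) x, phi (c%:A *: x) = c * phi x)
    & (forall k a x, (0 < k)%N -> ga_gr k a -> phi (a *: x) = 0)].

(** The component of cohomological degree [p] and lower grading [j] of the
    graded Hom from [P] to the trivial module, i.e. the degree-zero graded maps
    from [P_p] to [K[-j]]; since [K] sits in degree 0, such a map is supported on
    the internal degree [j] part of [P_p]. *)
Definition triv_hom (P : lmodType A) (gr : int * int -> P -> Prop) (p j : int)
    (phi : P -> K) : Prop :=
  triv_linear phi /\ forall ni x, gr ni x -> ni != (p, j) -> phi x = 0.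

(** The total module [P = (+)_n P_n]; [res_gr (n, i)] is the part of homological
    degree [n] and internal degree [i]. *)
Record freeResolution := FreeResolution {
  res_mod :> lmodType A;
  res_gr : int * int -> res_mod -> Prop;
  res_d : {linear res_mod -> res_mod};
  res_eps : res_mod -> K;
  res_graded : internal_grading (@whole res_mod) res_gr;
  res_act : forall k n i a x,
    ga_gr k a -> res_gr (n, i) x -> res_gr (n, i + k%:Z) (a *: x);
  res_neg : forall n i x, n < 0 -> res_gr (n, i) x -> x = 0;
  res_free : exists (B : eqType) (deg : B -> int * int) (e : B -> res_mod),
    [/\ (forall b, res_gr (deg b) (e b)),
        (forall x, exists (s : seq B) (c : B -> A),
            x = \sum_(b <- s) c b *: e b)
      & (forall (s : seq B) (c : B -> A), uniq s ->
            \sum_(b <- s) c b *: e b = 0 -> forall b, b \in s -> c b = 0)];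
  res_d_deg : forall n i x, res_gr (n, i) x -> res_gr (n - 1, i) (res_d x);
  res_eps_hom : triv_hom res_gr 0 0 res_eps;
  res_eps_onto : forall c : K, exists2 x, res_gr (0, 0) x & res_eps x = c;
  res_exact0 : forall i x, res_gr (0, i) x ->
    (res_eps x = 0 <-> exists2 y, res_gr (1, i) y & res_d y = x);
  res_exact : forall n i x, 0 < n -> res_gr (n, i) x ->
    (res_d x = 0 <-> exists2 y, res_gr (n + 1, i) y & res_d y = x)
}.

Definition minimal_resolution (P : freeResolution) : Prop :=
  forall x : P, lin_span
    (fun y => exists k a z, [/\ (0 < k)%N, ga_gr k a & y = a *: z]) (res_d P x).

Definition Delta (d n : nat) : nat * nat :=
  let k := (n %/ 3)%N in
  match (n %% 3)%N with
  | 0%N => (2 * d * k, 2 * d * k)%N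
  | 1%N => (2 * d * k + 1, 2 * d * k + 1)%N
  | _ => (2 * d * k + d, 2 * d * k + d + 1)%N
  end.

Definition generated_in_Delta (d : nat) (P : freeResolution) : Prop :=
  forall (n : nat) i (x : P), res_gr (n%:Z, i) x ->
    lin_span (fun y => res_gr (n%:Z, (Delta d n).1%:Z) y \/
                       res_gr (n%:Z, (Delta d n).2%:Z) y) x.

Definition bi_Koszul (d : nat) : Prop :=
  exists P : freeResolution, minimal_resolution P /\ generated_in_Delta d P.

(** * The differential graded algebra [End_A(P)] *)

(** Bihomogeneous elements: cohomological degree [p], lower grading [j].  The
    product is composition of functions. *)
Definition endo (P : freeResolution) (p j : int) (f : P -> P) : Prop :=
  linear f /\
  forall n i x, res_gr (n, i) x -> res_gr (n - p, i - j) (f x).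

Definition dEnd (P : freeResolution) (p : int) (f : P -> P) (x : P) : P :=
  res_d P (f x) - ksign A p *: f (res_d P x).

Definition chain_endo (P : freeResolution) (p j : int) (f : P -> P) : Prop :=
  endo p j f /\ forall x, dEnd p f x = 0.

(** * The Ext space *)

(** [E^p_j(A)] is the cohomology of the complex of graded Homs from [P] to the
    trivial module, presented by the linear map [ext_cls] sending a cocycle to its
    class; the values of [ext_cls] on non-homogeneous maps and on maps that are not
    cocycles are irrelevant. *)
Definition triv_cocycle (P : freeResolution) (p j : int) (phi : P -> K) : Prop :=
  triv_hom (@res_gr P) p j phi /\ forall x, phi (res_d P x) = 0.

Record extSpace (P : freeResolution) := ExtSpace {
  ext_mod :> lmodType K;
  ext_gr : int * int -> ext_mod -> Prop;
  ext_cls : (P -> K) -> ext_mod;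
  ext_graded : graded_space (@whole ext_mod) ext_gr;
  ext_cls_gr : forall p j phi, triv_cocycle p j phi -> ext_gr (p, j) (ext_cls phi);
  ext_cls_lin : forall p j (a : K) phi psi,
    triv_cocycle p j phi -> triv_cocycle p j psi ->
    ext_cls (fun x => a * phi x + psi x) = a *: ext_cls phi + ext_cls psi;
  ext_cls_onto : forall p j x, ext_gr (p, j) x ->
    exists2 phi, triv_cocycle p j phi & ext_cls phi = x;
  ext_cls_ker : forall p j phi, triv_cocycle p j phi ->
    (ext_cls phi = 0 <->
     exists2 psi, triv_hom (@res_gr P) (p - 1) j psi &
       forall x, phi x = psi (res_d P x))
}.

(** The class of a chain endomorphism of [P], under the canonical isomorphism
    from the cohomology of [End_A(P)] induced by the augmentation. *)
Definition ext_class (P : freeResolution) (E : extSpace P) (f : P -> P) : E :=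
  ext_cls E (fun x => res_eps (f x)).

Definition ext_unit (P : freeResolution) (E : extSpace P) : E :=
  ext_class E (fun x => x).

End Resolutions.

(** * A-infinity algebras *)

Section Ainfinity.
Variables (K : fieldType) (V : lmodType K).

(** A sequence of operations [m_n] is encoded as one function [m : seq V -> V],
    [m_n] being its restriction to sequences of size [n >= 1]; the value at the
    empty sequence is irrelevant. *)

(** [sum (-1)^(i + j t) g_{i+1+j} (1^i (x) m_t (x) 1^j)] evaluated at homogeneous
    [xs] of cohomological degrees [ps]; the second summand of the exponent is the
    Koszul sign of moving [m_t], of degree [2 - t], past the first [i] entries. *)
Definition stasheff_sum (R : pzRingType) (W : lmodType R) (g : seq V -> W)
    (m : seq V -> V) (ps : seq int) (xs : seq V) : W :=
  let n := size xs in
  \sum_(0 <= i < n) \sum_(1 <= t < (n - i).+1)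
    ksign R ((i + (n - i - t) * t)%N%:Z +
             (2 - t%:Z) * \sum_(p <- take i ps) p) *:
    g (take i xs ++ m (take t (drop i xs)) :: drop (i + t) xs).

Record Ainf_algebra (H : V -> Prop) (gr : int -> V -> Prop) (u : V)
    (m : seq V -> V) : Prop := AinfAlgebra {
  Ai_graded : graded_space H gr;
  Ai_closed : forall xs, (0 < size xs)%N -> all_in H xs -> H (m xs);
  Ai_multilinear : forall s1 s2 (a : K) x y,
    all_in H s1 -> all_in H s2 -> H x -> H y ->
    m (s1 ++ (a *: x + y) :: s2) = a *: m (s1 ++ x :: s2) + m (s1 ++ y :: s2);
  Ai_degree : forall ps xs, (0 < size xs)%N -> all_in H xs -> homs gr ps xs ->
    gr (\sum_(p <- ps) p + 2 - (size xs)%:Z) (m xs);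
  Ai_stasheff : forall ps xs, (0 < size xs)%N -> all_in H xs -> homs gr ps xs ->
    stasheff_sum m m ps xs = 0;
  Ai_unit_in : H u /\ gr 0 u;
  Ai_unit_mul : forall x, H x -> m [:: u; x] = x /\ m [:: x; u] = x;
  Ai_unit_strict : forall xs, all_in H xs -> u \in xs -> size xs != 2%N ->
    m xs = 0
}.

(** [(E; m_a, m_b, ...)]: keep the listed multiplications, all others are 0. *)
Definition only (ns : seq nat) (m : seq V -> V) (xs : seq V) : V :=
  if size xs \in ns then m xs else 0.

(** [(H; m_2, m'_t)] for a second operation [m'_t]. *)
Definition with_mult (t : nat) (m m' : seq V -> V) (xs : seq V) : V :=
  if size xs == 2%N then m xs else if size xs == t then m' xs else 0.

Definition Ainf_subalgebra (H' H : V -> Prop) (gr : int -> V -> Prop) (u : V)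
    (m : seq V -> V) : Prop :=
  [/\ Ainf_algebra H gr u m,
      (forall x, H' x -> H x),
      graded_space H' gr
    & (forall xs, (0 < size xs)%N -> all_in H' xs -> H' (m xs))].

Definition minimal_mults (H : V -> Prop) (m : seq V -> V) : Prop :=
  forall x, H x -> m [:: x] = 0.

Definition single (p : nat) (H : V -> Prop) (m : seq V -> V) : Prop :=
  [/\ (3 <= p)%N,
      minimal_mults H m
    & (forall xs, (0 < size xs)%N -> all_in H xs ->
         size xs \notin [:: 2%N; p] -> m xs = 0)].

(** Components of a bigrading [(p, j)]: cohomological degree, lower grading. *)
Variable bigr : int * int -> V -> Prop.

Definition coh (p : int) : V -> Prop := hsum bigr (fun pj => pj.1 = p).
Definition low (j : int) : V -> Prop := hsum bigr (fun pj => pj.2 = j).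

Definition preserves_low (H : V -> Prop) (m : seq V -> V) : Prop :=
  forall js xs, (0 < size xs)%N -> all_in H xs -> homs low js xs ->
    low (\sum_(j <- js) j) (m xs).

Definition pure (H : V -> Prop) (m : seq V -> V) : Prop :=
  [/\ graded_space H bigr,
      minimal_mults H m,
      preserves_low H m
    & (forall p, exists j, forall x, H x -> coh p x -> low j x)].

End Ainfinity.

(** * A-infinity-Ext-algebra structures *)

Section ExtAlgebra.
Variables (K : fieldType) (A : gradedAlgebra K) (P : freeResolution A).
Variable E : extSpace P.

Definition Ecoh : int -> E -> Prop := coh (@ext_gr _ _ _ E).
Definition Elow : int -> E -> Prop := low (@ext_gr _ _ _ E).

(** [f] is an A-infinity morphism from [(E, m)], [m_1 = 0], to the differential
    graded algebra [End_A(P)], whose only multiplications are its differential and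
    the composition: for all [n],
      sum (-1)^(i+jt) f_{i+1+j} (1^i (x) m_t (x) 1^j)
        = d f_n + sum_{i+k=n} (-1)^(i-1) f_i f_k,
    again evaluated on elements with Koszul signs ([f_k] has degree [1 - k]).  It
    preserves the lower grading, is a quasi-isomorphism, and lifts the identity of
    the cohomology. *)
Record Ainf_quasi_iso (m : seq E -> E) (f : seq E -> P -> P) : Prop := {
  qi_multilinear : forall s1 s2 (a : K) (x y : E) (v : P),
    f (s1 ++ (a *: x + y) :: s2) v =
    (a%:A : A) *: f (s1 ++ x :: s2) v + f (s1 ++ y :: s2) v;
  qi_degree : forall (ps : seq (int * int)) xs, (0 < size xs)%N ->
    homs (@ext_gr _ _ _ E) ps xs ->
    endo (\sum_(p <- ps) p.1 + 1 - (size xs)%:Z) (\sum_(p <- ps) p.2) (f xs);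
  qi_morphism : forall (ps : seq (int * int)) xs (v : P), (0 < size xs)%N ->
    homs (@ext_gr _ _ _ E) ps xs ->
    stasheff_sum (fun ys => f ys v) m [seq p.1 | p <- ps] xs =
    dEnd (\sum_(p <- ps) p.1 + 1 - (size xs)%:Z) (f xs) v +
    \sum_(1 <= i < size xs)
      ksign A (i.-1%:Z + (1 - (size xs - i)%N%:Z) * \sum_(p <- take i ps) p.1) *:
      f (take i xs) (f (drop i xs) v);
  qi_injective : forall p j x h, ext_gr (p, j) x -> @endo _ _ P (p - 1) j h ->
    (forall v, f [:: x] v = dEnd (p - 1) h v) -> x = 0;
  qi_surjective : forall p j z, @chain_endo _ _ P p j z ->
    exists x h, [/\ ext_gr (p, j) x, @endo _ _ P (p - 1) j h
      & forall v, z v = f [:: x] v + dEnd (p - 1) h v];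
  qi_lifts_id : forall p j x, ext_gr (p, j) x -> ext_class E (f [:: x]) = x
}.

Record Ainf_Ext_structure (m : seq E -> E) : Prop := {
  AE_algebra : Ainf_algebra (@whole E) Ecoh (ext_unit E) m;
  AE_minimal : minimal_mults (@whole E) m;
  AE_low : preserves_low (@ext_gr _ _ _ E) (@whole E) m;
  AE_Yoneda : forall p j q l (z w : P -> P),
    chain_endo p j z -> chain_endo q l w ->
    m [:: ext_class E z; ext_class E w] = ext_class E (z \o w);
  AE_quasi_iso : exists f : seq E -> P -> P, Ainf_quasi_iso m f
}.

(** * Truncated bi-Koszul algebras *)

(** Names of the pieces [E^{[0]}], [E^{[1]}], [E^{[2]}_{(d)}], [E^{[2]}_{(d+1)}]. *)
Variant piece := B0 | B1 | B2d | B2d1.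

Definition piece_code (q : piece) : nat :=
  match q with B0 => 0 | B1 => 1 | B2d => 2 | B2d1 => 3 end.
Definition piece_decode (n : nat) : piece :=
  match n with 0 => B0 | 1 => B1 | 2 => B2d | _ => B2d1 end%N.
Lemma piece_codeK : cancel piece_code piece_decode.
Proof. by case. Qed.
HB.instance Definition _ := Equality.copy piece (can_type piece_codeK).

Definition bracket (r : nat) : E -> Prop :=
  hsum (@ext_gr _ _ _ E) (fun pj => exists k : nat, pj.1 = (3 * k + r)%N%:Z).

Definition bracket2 (d l : nat) : E -> Prop :=
  hsum (@ext_gr _ _ _ E) (fun pj => exists k : nat,
    pj = ((3 * k + 2)%N%:Z, (2 * d * k + l)%N%:Z)).

Definition in_piece (d : nat) (q : piece) : E -> Prop :=
  match q with
  | B0 => bracket 0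
  | B1 => bracket 1
  | B2d => bracket2 d d
  | B2d1 => bracket2 d d.+1
  end.

(** [trunc_rule d w r]: the multiplication of arity [size w] may be non-zero on the
    tensor product of the pieces [w], with values in [bracket r]. *)
Inductive trunc_rule (d : nat) (w : seq piece) : nat -> Prop :=
| m2_00 of perm_eq w [:: B0; B0] : trunc_rule d w 0
| m2_01 of perm_eq w [:: B0; B1] : trunc_rule d w 1
| m2_22 of perm_eq w [:: B2d; B2d1] : trunc_rule d w 1
| m2_02d of perm_eq w [:: B0; B2d] : trunc_rule d w 2
| m2_02d1 of perm_eq w [:: B0; B2d1] : trunc_rule d w 2
| md_0 of perm_eq w (B2d1 :: nseq d.-1 B1) : trunc_rule d w 0
| md_2 of w = nseq d B1 : trunc_rule d w 2
| md1_0 of perm_eq w (B2d :: nseq d B1) : trunc_rule d w 0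
| md1_2 of w = nseq d.+1 B1 : trunc_rule d w 2.

Definition truncated (d : nat) (m : seq E -> E) : Prop :=
  [/\ (forall xs, (0 < size xs)%N -> size xs \notin [:: 2%N; d; d.+1] ->
         m xs = 0),
      (forall w r xs, trunc_rule d w r -> homs (in_piece d) w xs ->
         bracket r (m xs))
    & (forall w xs, (0 < size w)%N -> (forall r, ~ trunc_rule d w r) ->
         homs (in_piece d) w xs -> m xs = 0)].

(** The sum of the listed pieces. *)
Definition piece_sum (d : nat) (qs : seq piece) (x : E) : Prop :=
  exists g : piece -> E,
    (forall q, in_piece d q (g q)) /\ x = \sum_(q <- qs) g q.

Definition Fpieces : seq piece := [:: B0; B1; B2d].
Definition Gpieces : seq piece := [:: B0; B1; B2d1].

(** [m_t] on [H], the sum of the pieces [qs], is determined by [m_2] and the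
    restriction of [m_t] to the [t]-th tensor power of [E^1]. *)
Definition determined (d : nat) (qs : seq piece) (t : nat) (m : seq E -> E) :
    Prop :=
  let H := piece_sum d qs in
  forall m' : seq E -> E,
    Ainf_algebra H Ecoh (ext_unit E) (with_mult t m m') ->
    (forall js xs, size xs = t -> all_in H xs -> homs Elow js xs ->
       Elow (\sum_(j <- js) j) (m' xs)) ->
    (forall w xs, size w = t -> all (mem qs) w -> w <> nseq t B1 ->
       homs (in_piece d) w xs -> m' xs = 0) ->
    (forall xs, size xs = t -> all_in (Ecoh 1) xs -> m' xs = m xs) ->
    forall xs, size xs = t -> all_in H xs -> m' xs = m xs.

End ExtAlgebra.

(* Main.v *)
(* The components of [E] live in the bidegrees [(n, Delta d n)]: a cocycle on any
   resolution is pulled back, up to homotopy, from one generated in those degrees.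
   Hence on [F] and [G] the cohomological degree determines the lower grading, and
   bidegrees force [m_2] and [m_t] to preserve [F] and [G].  The arities [2, d, d+1]
   composed in pairs have distinct sums for [d >= 4], so the Stasheff identities of
   [(E; m_2, m_d, m_{d+1})] contain those of [(E; m_2, m_d)] and [(E; m_2, m_{d+1})].

   For the uniqueness of [m_t], the point is that [E^{3k+1} = E^1 E^{3k}].  In the
   Stasheff identity on [x_1, ..., x_i, y, z, x_{i+2}, ...] with [y] in [E^1] and [z]
   in [E^{3k}], almost all terms vanish because [m_t] is zero on [E^{[0]}], and it
   remains
     m_t(..., y z, x_{i+2}, ...) = +- m_t(..., y, z x_{i+2}, ...),
   or +- m_t(..., y) z for the last entry.  Moving the factors [z] to the right
   turns all entries into elements of [E^1]. *)

From HB Require Import structures.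
Require Import Defs.
From mathcomp Require Import all_boot all_order all_algebra.
From mathcomp Require Import boolp classical_sets zify.

Set Implicit Arguments.
Unset Strict Implicit.
Unset Printing Implicit Defensive.

Import Order.TTheory GRing.Theory Num.Theory.
Local Open Scope ring_scope.

(** Two points shape the argument. The rewriting of entries runs only to the right because [y]
    stands before [z]: a window of [t] among the [t + 1] entries that starts at the second one
    contains [z], so no term z m_t(...) arises, and a product of two neighbours in E^{[1]} is zero.
    The formula for m_t is never solved; the Stasheff identities of the two structures are
    subtracted term by term, and of the signs it only matters that they are invertible.

    The modules of a resolution may have infinite rank. Functionals given on a subspace are
    therefore extended by Zorn's lemma, and the only finite family in use is one spanning A_1. Its
    coordinate functionals turn a functional on A_1 P'_{3k} into a finite sum, and this sum is what
    becomes a sum of products in E^1 E^{3k}. *)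

Lemma sum_fibers (V : nmodType) (T I : eqType) (h : T -> I) (s : seq T)
    (u : seq I) (F : T -> V) :
  uniq u -> {subset map h s <= u} ->
  \sum_(x <- s) F x = \sum_(i <- u) \sum_(x <- s | h x == i) F x.
Proof.
move=> uu su; rewrite (exchange_big_dep predT) //= big_seq [RHS]big_seq.
apply: eq_bigr => x xs; have hu : h x \in u by apply/su/map_f.
rewrite -big_filter (eq_filter (a2 := pred1 (h x))) ?filter_pred1_uniq //.
by rewrite big_seq1.
Qed.

(** * Homogeneous components *)

Section GradedGroup.
Variables (I : eqType) (V : zmodType) (gr : I -> V -> Prop).
Hypothesis gV : internal_grading (@whole V) gr.

Lemma gr0 i : gr i 0. Proof. by case: gV => _ /(_ i)[]. Qed.
Lemma grB i x y : gr i x -> gr i y -> gr i (x - y).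
Proof. by case: gV => _ /(_ i)[_ +] _ _; apply. Qed.
Lemma grN i x : gr i x -> gr i (- x).
Proof. by rewrite -(sub0r x); apply/grB/gr0. Qed.
Lemma grD i x y : gr i x -> gr i y -> gr i (x + y).
Proof. by rewrite -{2}(opprK y) => gx /grN; apply: grB. Qed.
Lemma gr_sum i (T : Type) (s : seq T) (Q : pred T) (F : T -> V) :
  (forall t, Q t -> gr i (F t)) -> gr i (\sum_(t <- s | Q t) F t).
Proof. by move=> h; elim/big_ind: _ => //; [apply: gr0 | apply: grD]. Qed.

Lemma hsum_uniq (S : I -> Prop) x : hsum gr S x -> exists (s : seq I) f,
  [/\ uniq s, forall i, gr i (f i), forall i, i \in s -> S i
     & x = \sum_(i <- s) f i].
Proof.
case=> s [f [gf Ss ->]].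
exists (undup s), (fun i => \sum_(j <- s | j == i) f j); split.
- exact: undup_uniq.
- by move=> i; apply: gr_sum => j /eqP <-.
- by move=> i; rewrite mem_undup; apply: Ss.
by apply: sum_fibers; rewrite ?undup_uniq // map_id => i; rewrite mem_undup.
Qed.

Lemma hsumB (S : I -> Prop) x y : hsum gr S x -> hsum gr S y -> hsum gr S (x - y).
Proof.
move=> /hsum_uniq[s [f [us gf Ss ->]]] /hsum_uniq[t [g [ut gg St ->]]].
exists (undup (s ++ t)),
  (fun i => \sum_(j <- s | j == i) f j - \sum_(j <- t | j == i) g j); split.
- by move=> i; apply: grB; apply: gr_sum => j /eqP <-.
- by move=> i; rewrite mem_undup mem_cat => /orP[/Ss|/St].
by rewrite sumrB; congr (_ - _); apply: sum_fibers; rewrite ?undup_uniq //;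
  rewrite map_id => i; rewrite mem_undup mem_cat => ->; rewrite ?orbT.
Qed.

Lemma hsum0 (S : I -> Prop) : hsum gr S 0.
Proof. by exists [::], (fun=> 0); split=> // [i|]; [apply: gr0 | rewrite big_nil]. Qed.
Lemma hsumN (S : I -> Prop) x : hsum gr S x -> hsum gr S (- x).
Proof. by rewrite -(sub0r x); apply/hsumB/hsum0. Qed.
Lemma hsumD (S : I -> Prop) x y : hsum gr S x -> hsum gr S y -> hsum gr S (x + y).
Proof. by rewrite -{2}(opprK y) => hx /hsumN; apply: hsumB. Qed.

Lemma hsum_gr (S : I -> Prop) i x : S i -> gr i x -> hsum gr S x.
Proof.
move=> Si gx; exists [:: i], (fun j => if j == i then x else 0); split.
- by move=> j; case: eqP => [->|_] //; apply: gr0.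
- by move=> j; rewrite inE => /eqP ->.
by rewrite big_seq1 eqxx.
Qed.

Lemma gr_hsum_eq0 i x : gr i x -> hsum gr (fun k => k <> i) x -> x = 0.
Proof.
move=> gx /hsum_uniq[s [f [us gf Ss xE]]].
have nis : i \notin s by apply/negP => /Ss.
(* With [-x] placed at [i] the family sums to 0, and directness of the grading kills each of its
   members. *)
pose g j := if j == i then - x else f j.
suff : g i = 0 by rewrite /g eqxx => /eqP; rewrite oppr_eq0 => /eqP.
case: gV => _ _ _ /(_ (i :: s) g); apply; rewrite /= ?nis ?mem_head //.
  by move=> j; split=> //; rewrite /g; case: eqP => [->|//]; apply: grN.
rewrite big_cons /g eqxx xE; apply/eqP; rewrite addrC subr_eq0; apply/eqP.
by apply: eq_big_seq => j js; case: eqP => // ji; rewrite -ji js in nis.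
Qed.

Lemma hpart_ex i x : exists y, gr i y /\ hsum gr (fun k => k <> i) (x - y).
Proof.
case: gV => _ _ /(_ x Logic.I)[s [f [gf ->]]] _.
exists (\sum_(j <- s | j == i) f j); split.
  by apply: gr_sum => j /eqP <-; case: (gf j).
rewrite (bigID (fun j => j == i)) /= addrC addrK -big_filter.
exists [seq j <- s | j != i], f; split=> // [j|j]; first by case: (gf j).
by rewrite mem_filter => /andP[/eqP].
Qed.

(** The grading only asserts that decompositions exist, so the component is chosen; [hpart_uniq]
    makes the choice harmless. *)
Definition hpart i x : V := projT1 (cid (hpart_ex i x)).

Lemma hpart_gr i x : gr i (hpart i x).
Proof. by rewrite /hpart; case: cid => y []. Qed.
Lemma hpart_off i x : hsum gr (fun k => k <> i) (x - hpart i x).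
Proof. by rewrite /hpart; case: cid => y []. Qed.

Lemma hpart_uniq i x y :
  gr i y -> hsum gr (fun k => k <> i) (x - y) -> hpart i x = y.
Proof.
move=> gy oy; apply/eqP; rewrite -subr_eq0; apply/eqP; apply: (@gr_hsum_eq0 i).
  by apply: grB => //; apply: hpart_gr.
by have := hsumB oy (hpart_off i x); rewrite opprB addrC addrA subrK.
Qed.

Lemma hpartD i x y : hpart i (x + y) = hpart i x + hpart i y.
Proof.
apply: hpart_uniq; first by apply: grD; apply: hpart_gr.
by rewrite opprD addrACA; apply: hsumD; apply: hpart_off.
Qed.

Lemma hpart_id i x : gr i x -> hpart i x = x.
Proof. by move=> gx; apply: hpart_uniq => //; rewrite subrr; apply: hsum0. Qed.

Lemma hpart_ne i j x : gr j x -> j != i -> hpart i x = 0.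
Proof.
move=> gx ji; apply: hpart_uniq; first exact: gr0.
by rewrite subr0; apply: (hsum_gr (i := j)) => //; apply/eqP.
Qed.

Lemma hpart0 i : hpart i 0 = 0. Proof. exact/hpart_id/gr0. Qed.

Lemma hpart_sum i (T : Type) (s : seq T) (Q : pred T) (F : T -> V) :
  hpart i (\sum_(t <- s | Q t) F t) = \sum_(t <- s | Q t) hpart i (F t).
Proof. by apply: (big_morph (hpart i)); [apply: hpartD | apply: hpart0]. Qed.

Lemma hpart_supp x : exists2 s, uniq s & x = \sum_(i <- s) hpart i x.
Proof.
have [s [f [us gf _ xE]]] : exists (s : seq I) f,
    [/\ uniq s, forall i, gr i (f i), forall i, i \in s -> True
       & x = \sum_(i <- s) f i].
  apply: hsum_uniq; case: gV => _ _ /(_ x Logic.I)[s [f [gf ->]]] _.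
  by exists s, f; split=> // i; case: (gf i).
exists s => //; rewrite {1}xE; apply: eq_big_seq => i si.
rewrite xE hpart_sum (bigD1_seq i) //= (hpart_id (gf i)) big1 ?addr0 // => j ji.
exact: hpart_ne (gf j) ji.
Qed.

(** Membership in a sum of pieces becomes a test on the non-zero components, the form in which all
    degree arguments use it. *)
Lemma hsumP (S : I -> Prop) x :
  hsum gr S x <-> forall i, hpart i x <> 0 -> S i.
Proof.
split.
  move=> [s [f [gf Ss ->]]] i; apply: contra_notP => Si.
  rewrite hpart_sum big1_seq // => j /= /Ss Sj; apply: hpart_ne (gf j) _.
  by apply/eqP => ji; rewrite -ji in Si.
move=> h; case: (hpart_supp x) => s us {1}->.
rewrite (bigID (fun i => hpart i x == 0)) /= big1 ?add0r => [|i /eqP //].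
rewrite -big_filter; exists [seq i <- s | hpart i x != 0], (hpart ^~ x); split=> //.
  by move=> i; apply: hpart_gr.
by move=> i; rewrite mem_filter => /andP[/eqP/h].
Qed.

End GradedGroup.

(** Injectivity of [sg] keeps the components other than [i] away from [sg i]. It serves for
    multiplication by a homogeneous element and for the differential. *)
Lemma hpart_map (I J : eqType) (V W : zmodType) (gr : I -> V -> Prop)
    (gr' : J -> W -> Prop) (gV : internal_grading (@whole V) gr)
    (gW : internal_grading (@whole W) gr') (f : {additive V -> W})
    (sg : I -> J) : injective sg -> (forall i x, gr i x -> gr' (sg i) (f x)) ->
  forall i x, hpart gW (sg i) (f x) = f (hpart gV i x).
Proof.
move=> isg fgr i x; apply: hpart_uniq; first by apply: fgr; apply: hpart_gr.
rewrite -raddfB; have [s [g [gg Ss ->]]] := hpart_off gV i x.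
rewrite raddf_sum big_seq; elim/big_rec: _ => [|j y js hy]; first exact: hsum0.
apply: (hsumD gW) => //; apply: (hsum_gr gW (i := sg j)); last exact: fgr.
by move=> /isg; apply: Ss.
Qed.

(** * Functionals over the ground field *)

Section Functionals.
Variables (K : fieldType) (A : algType K).

(** The ground field acts on an [A]-module only through the scalars [c%:A]. *)
Definition klinear (V : lmodType A) (f : V -> K) : Prop :=
  (forall x y, f (x + y) = f x + f y) /\ (forall c x, f (c%:A *: x) = c * f x).

Lemma klinear0 (V : lmodType A) (f : V -> K) : klinear f -> f 0 = 0.
Proof. by case=> _ /(_ 0 0); rewrite scaler0 mul0r. Qed.

Lemma klinear_sum (V : lmodType A) (f : V -> K) (T : Type) (s : seq T)
    (Q : pred T) (F : T -> V) : klinear f ->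
  f (\sum_(t <- s | Q t) F t) = \sum_(t <- s | Q t) f (F t).
Proof. by move=> kf; apply: (big_morph f); [case: kf | apply: klinear0]. Qed.

(* Zorn's lemma is applied to the linear relations in [V * K]; the clause on [G]
   lets the empty relation through, so that empty chains have an upper bound. *)
Lemma klinear_extension (V : lmodType A) (G : V -> K -> Prop) :
    G 0 0 ->
    (forall a x c y e, G x c -> G y e -> G (a%:A *: x + y) (a * c + e)) ->
    (forall c, G 0 c -> c = 0) ->
  exists2 f : V -> K, klinear f & forall x c, G x c -> f x = c.
Proof.
move=> G00 Glin Gfun.
pose ok (X : set (V * K)) :=
  [/\ forall a p q, X p -> X q -> X (a%:A *: p.1 + q.1, a * p.2 + q.2),
      forall c, X (0, c) -> c = 0
    & forall p, X p -> forall q, G q.1 q.2 -> X q].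
have [F Fok Ftot|X [Xok Xmax]] := @Zorn_bigcup _ ok.
  split.
  - move=> a p q [Y FY Yp] [Z FZ Zq].
    by case: (Ftot _ _ FY FZ) => [YZ|ZY]; [exists Z | exists Y] => //;
      [case: (Fok _ FZ) => + _ _ | case: (Fok _ FY) => + _ _]; apply; auto.
  - by move=> c [Y FY]; case: (Fok _ FY) => _ + _; apply.
  - by move=> p [Y FY Yp] q Gq; exists Y => //; case: (Fok _ FY) => _ _ /(_ p); apply.
have GX q : G q.1 q.2 -> X q.
  move=> Gq; apply: contrapT => nXq.
  apply: (Xmax [set p | G p.1 p.2]%classic).
    split; last by move=> /(_ q Gq).
    by move=> p Xp; case: nXq; case: Xok => _ _ /(_ p Xp); apply.
  by split=> [a p p' /=|c /=|p _ p' //]; [apply: Glin | apply: Gfun].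
have X00 : X (0, 0) by apply: GX.
case: Xok => Xlin Xfun _.
have Xdom x : exists c, X (x, c).
  (* If [x] is outside the domain, giving it the value 0 enlarges the relation, against
     maximality. *)
  apply: contrapT => nx.
  apply: (Xmax [set p | exists t q, X q /\ p = (t%:A *: x + q.1, q.2)]%classic).
    split.
      by move=> p Xp; exists 0, p; rewrite scale0r scale0r add0r -surjective_pairing.
    move=> sub; case: nx; exists 0; apply: sub; exists 1, (0, 0).
    by rewrite scale1r scale1r addr0.
  split.
  - move=> a _ _ [t [q [Xq ->]]] [u [r [Xr ->]]] /=.
    exists (a * t + u), (a%:A *: q.1 + r.1, a * q.2 + r.2); split; first exact: Xlin.
    congr (_, _) => /=.
    by rewrite scalerDr scalerA -scalerAl mul1r scalerA !scalerDl addrACA.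
  (* A non-zero [t] would express [x] through [q.1], which lies in the domain already. *)
  - move=> c [t [q [Xq [q1 ->]]]]; have [t0|t0] := eqVneq t 0.
      move: q1; rewrite t0 scale0r scale0r add0r => q1.
      by apply: Xfun; rewrite q1 -surjective_pairing.
    case: nx; exists (- t^-1 * q.2 + 0).
    have := Xlin (- t^-1) q (0, 0) Xq X00; rewrite /= addr0.
    congr (X (_, _)); move/eqP: q1; rewrite eq_sym addrC addr_eq0 => /eqP ->.
    by rewrite scalerN -scaleNr -scaleNr opprK scalerA -scalerAl mul1r scalerA
      mulVf // scale1r scale1r.
  - by move=> p _ q Gq; exists 0, q; rewrite scale0r scale0r add0r -surjective_pairing; auto.
have [f fX] := choice Xdom.
have uX x c e : X (x, c) -> X (x, e) -> c = e.
  move=> Xc Xe; have /= := Xlin (-1) _ _ Xc Xe.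
  rewrite scaleN1r scaleN1r addNr mulN1r addrC => /Xfun/eqP.
  by rewrite subr_eq0 => /eqP.
exists f; last by move=> x c /(GX (x, c)); apply: uX.
split=> [x y|c x]; apply: uX (fX _) _.
  by have /= := Xlin 1 _ _ (fX x) (fX y); rewrite scale1r scale1r mul1r.
by have /= := Xlin c _ _ (fX x) X00; rewrite !addr0.
Qed.

(** The family need not be independent: a vector in the span of the earlier ones gets the zero
    functional. Otherwise a functional with value 1 on it and 0 on the earlier ones exists, and the
    earlier coordinates are taken after subtracting its contribution. *)
Lemma dual_family (V : lmodType A) (b : nat -> V) (r : nat) :
  exists2 a : nat -> V -> K, forall i, klinear (a i) &
    forall (c : nat -> K) v, v = \sum_(i < r) (c i)%:A *: b i ->
      v = \sum_(i < r) (a i v)%:A *: b i.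
Proof.
elim: r => [|r [a ka aE]].
  exists (fun _ _ => 0); last by move=> c v; rewrite !big_ord0.
  by split=> *; rewrite ?addr0 ?mulr0.
pose sp v := exists c : nat -> K, v = \sum_(i < r) (c i)%:A *: b i.
have splin t v w : sp v -> sp w -> sp (t%:A *: v + w).
  move=> [c ->] [e ->]; exists (fun i => t * c i + e i).
  rewrite scaler_sumr -big_split /=; apply: eq_bigr => i _.
  by rewrite scalerA -scalerAl mul1r scalerA !scalerDl.
have sp0 : sp 0 by exists (fun=> 0); rewrite big1 // => i _; rewrite !scale0r.
have [brs|brs] := EM (sp (b r)).
  exists (fun i v => if i == r then 0 else a i v).
    by move=> i; case: eqP => // _; split=> [x y|c x]; rewrite ?addr0 ?mulr0.
  move=> c v vE.
  have [e {}vE] : sp v.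
    rewrite vE big_ord_recr /= addrC; apply: splin => //.
    by exists c.
  rewrite big_ord_recr /= eqxx !scale0r addr0 {1}(aE _ _ vE).
  by apply: eq_bigr => i _; rewrite (ltn_eqF (ltn_ord i)).
have [|||x kx xE] := @klinear_extension V
    (fun v c => exists2 w, sp w & v = c%:A *: b r + w).
- by exists 0; rewrite // !scale0r addr0.
- move=> t _ c _ e [v sv ->] [w sw ->]; exists (t%:A *: v + w); first exact: splin.
  by rewrite scalerDr scalerA -scalerAl mul1r scalerA !scalerDl addrACA.
- move=> c [w sw /eqP]; rewrite eq_sym addr_eq0 => /eqP cE.
  apply/eqP; apply/negP => /negP c0; case: brs.
  suff -> : b r = (- c^-1)%:A *: w + 0 by apply: splin.
  rewrite addr0 -(opprK w) -cE scalerN -scaleNr -scaleNr opprK scalerA.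
  by rewrite -scalerAl mul1r scalerA mulVf // !scale1r.
have [a0 aZ] := kx.
exists (fun i v => if i == r then x v else a i (v - (x v)%:A *: b r)).
  move=> i; case: eqP => // _; case: (ka i) => aD aZ'; split=> [v w|c v].
    by rewrite -aD a0 !scalerDl opprD addrACA.
  by rewrite -aZ' aZ scalerBr scalerA -scalerAl mul1r scalerA.
move=> c v; rewrite big_ord_recr /= => vE.
have xv : x v = c r by apply: xE; rewrite vE addrC; eexists; [exists c | ].
rewrite big_ord_recr /= eqxx xv {1}vE (aE c _ erefl); congr (_ + _).
by apply: eq_bigr => i _; rewrite (ltn_eqF (ltn_ord i)) vE addrK.
Qed.

End Functionals.

(** * Free resolutions *)

Lemma ksign_cases (R : pzRingType) p : ksign R p = 1 \/ ksign R p = -1.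
Proof. by rewrite /ksign -signr_odd; case: odd; [right|left]. Qed.

Lemma ksignC (R : pzRingType) p (a : R) : ksign R p * a = a * ksign R p.
Proof. by case: (ksign_cases R p) => ->; rewrite ?mulN1r ?mulrN1 ?mul1r ?mulr1. Qed.

Lemma ksignK (R : pzRingType) p : ksign R p * ksign R p = 1.
Proof. by case: (ksign_cases R p) => ->; rewrite ?mulN1r ?opprK ?mul1r. Qed.

Lemma ksign_alg (K : fieldType) (A : algType K) p : ksign A p = (ksign K p)%:A.
Proof. by rewrite /ksign -(signr_odd A) -(signr_odd K); case: odd;
  rewrite ?scaleN1r ?scale1r.
Qed.

Section Resolutions.
Variables (K : fieldType) (A : gradedAlgebra K).

Let gA : internal_grading (@whole A) (@ga_gr K A).
Proof. by case: (ga_graded A). Qed.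

(** The scalar is the degree-zero component of [a]; components of positive degree act by zero on the
    trivial module. It depends on [a] alone, so it can be shared by different modules and
    functionals. *)
Lemma augmentation (a : A) : exists c : K, forall (P : lmodType A) (phi : P -> K),
  triv_linear phi -> forall x, phi (a *: x) = c * phi x.
Proof.
have [c cE] : exists c : K, hpart gA 0 a = c%:A.
  by apply/ga_connected; apply: hpart_gr.
have [s [f [gf Ss aE]]] := hpart_off gA 0 a.
exists c => P phi [phiD phiZ phiJ] x.
have phi0 : phi 0 = 0 by have := phiZ 0 0; rewrite scaler0 mul0r.
rewrite -[a](subrK (hpart gA 0 a)) scalerDl phiD cE phiZ -cE aE scaler_suml.
rewrite (big_morph phi phiD phi0) big1_seq ?add0r // => i /= /Ss i0.
by apply: phiJ (gf i); lia.
Qed.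

Lemma triv_comp (P Q : lmodType A) (f : {linear P -> Q}) (phi : Q -> K) :
  triv_linear phi -> triv_linear (phi \o f).
Proof.
move=> [pD pZ pJ]; split=> [x y|c x|k a x k0 ak] /=; rewrite ?linearD ?linearZ //=.
exact: pJ ak.
Qed.

Lemma triv_linear_klinear (P : lmodType A) (phi : P -> K) :
  triv_linear phi -> klinear phi.
Proof. by case. Qed.

Section OneResolution.
Variable P : freeResolution A.
Let gP := res_graded P.

(** Only the component of [a] of degree [i - i'] contributes; [a' = 0] covers the bidegrees that
    multiples of [y] cannot reach. *)
Lemma act_part n i n' i' (y : P) a : res_gr (n', i') y -> exists a',
  hpart gP (n, i) (a *: y) = a' *: y /\
  (a' = 0 \/ exists k : nat, ga_gr k a' /\ (n, i) = (n', i' + k%:Z)).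
Proof.
move=> gy.
have [[nn ii]|ne] := EM (n = n' /\ i' <= i); last first.
  exists 0; split; last by left.
  have [s _ ->] := hpart_supp gA a.
  rewrite scaler_suml hpart_sum scale0r big1 // => k _.
  apply: hpart_ne (res_act (hpart_gr gA k a) gy) _.
  by apply/eqP => -[e1 e2]; apply: ne; split=> //; lia.
have [k kE] : exists k : nat, i = i' + k%:Z by exists `|i - i'|%N; lia.
exists (hpart gA k a); split; last first.
  by right; exists k; rewrite nn kE; split=> //; apply: hpart_gr.
have [s [f [gf Ss aE]]] := hpart_off gA k a.
rewrite -{1}[a](subrK (hpart gA k a)) scalerDl hpartD aE scaler_suml hpart_sum.
rewrite big1_seq ?add0r => [|l /= /Ss lk]; last first.
  apply: hpart_ne (res_act (gf l) gy) _.
  by apply/eqP => -[e1 e2]; apply: lk; lia.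
by rewrite hpart_id // nn kE; apply: res_act => //; apply: hpart_gr.
Qed.

Lemma hpart_act k (a : A) n i (x : P) : ga_gr k a ->
  hpart gP (n, i + k%:Z) (a *: x) = a *: hpart gP (n, i) x.
Proof.
move=> ak; apply: (@hpart_map _ _ _ _ _ _ gP gP ( *:%R a)
  (fun ni => (ni.1, ni.2 + k%:Z)) _ _ (n, i)); last by move=> [n' i'] y; apply: res_act.
by move=> [n1 i1] [n2 i2] [/= -> /addIr ->].
Qed.

Lemma hpart_d n i (x : P) : hpart gP (n - 1, i) (res_d P x) = res_d P (hpart gP (n, i) x).
Proof.
apply: (@hpart_map _ _ _ _ _ _ gP gP (res_d P) (fun ni => (ni.1 - 1, ni.2))
  _ _ (n, i)).
  by move=> [n1 i1] [n2 i2] [/= /addIr -> ->].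
by move=> [n' i'] y; apply: res_d_deg.
Qed.

Lemma ksign_gr p ni (x : P) : res_gr ni x -> res_gr ni (ksign A p *: x).
Proof.
by case: (ksign_cases A p) => ->; rewrite ?scale1r ?scaleN1r //; apply: (grN gP).
Qed.

Lemma scalar_gr (c : K) ni (x : P) : res_gr ni x -> res_gr ni (c%:A *: x).
Proof.
case: ni => n i gx; have := @res_act _ _ P 0 n i c%:A x; rewrite addr0; apply=> //.
by apply/ga_connected; exists c.
Qed.

(** A boundary lies in the image, hence in the kernel by exactness; for [n <= 1] the target sits in
    negative homological degree. *)
Lemma res_dd (x : P) : res_d P (res_d P x) = 0.
Proof.
have [s _ ->] := hpart_supp gP x; rewrite !linear_sum big1 // => -[n i] _.
have gx := hpart_gr gP (n, i) x; have gdx := res_d_deg gx.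
have [n1|n1] := lerP n 1; first by apply: res_neg (res_d_deg gdx); lia.
by apply/(res_exact _ gdx); [lia | exists (hpart gP (n, i) x); rewrite ?subrK].
Qed.

Lemma res_eps_d (x : P) : res_eps (res_d P x) = 0.
Proof.
have [phiL phi0] := res_eps_hom P; have kphi := triv_linear_klinear phiL.
have [s _ ->] := hpart_supp gP x.
rewrite linear_sum (klinear_sum _ _ _ kphi) big1 // => -[n i] _.
have gx := hpart_gr gP (n, i) x; have gdx := res_d_deg gx.
have [ni|ni] := eqVneq (n - 1, i) (0, 0); last exact: phi0 gdx ni.
case: ni gx gdx => n1 ->; rewrite n1 => gx gdx.
by apply/(res_exact0 gdx); exists (hpart gP (n, 0) x) => //; rewrite (_ : 1 = n) //; lia.
Qed.

Lemma triv_homE p j (phi psi : P -> K) :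
  triv_hom (@res_gr K A P) p j phi -> triv_hom (@res_gr K A P) p j psi ->
  (forall x, res_gr (p, j) x -> phi x = psi x) -> forall x, phi x = psi x.
Proof.
move=> [phiL phi0] [psiL psi0] eq_pj x; have [s _ ->] := hpart_supp gP x.
rewrite (klinear_sum _ _ _ (triv_linear_klinear phiL)).
rewrite (klinear_sum _ _ _ (triv_linear_klinear psiL)); apply: eq_bigr => ni _.
have gx := hpart_gr gP ni x; have [ni_pj|ne] := eqVneq ni (p, j).
  by rewrite ni_pj in gx *; apply: eq_pj.
by rewrite (phi0 _ _ gx ne) (psi0 _ _ gx ne).
Qed.

(** * Maps out of a free module *)

Section Basis.
Variables (B : eqType) (deg : B -> int * int) (e : B -> P).
Hypothesis e_gr : forall b, res_gr (deg b) (e b).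
Hypothesis e_span : forall x, exists (s : seq B) (c : B -> A),
  x = \sum_(b <- s) c b *: e b.
Hypothesis e_free : forall (s : seq B) (c : B -> A), uniq s ->
  \sum_(b <- s) c b *: e b = 0 -> forall b, b \in s -> c b = 0.

Lemma basis_neg b : (0 <= (deg b).1).
Proof.
rewrite leNgt; apply/negP => n0; have := e_gr b.
case: (deg b) n0 => n i /= n0 /(res_neg n0) e0.
have := @e_free [:: b] (fun=> 1); rewrite big_seq1 e0 scaler0.
by move=> /(_ isT erefl b (mem_head _ _)) /eqP; rewrite oner_eq0.
Qed.

Lemma basis_ind (T : P -> Prop) :
  T 0 -> (forall a x y, T x -> T y -> T (a *: x + y)) -> (forall b, T (e b)) ->
  forall x, T x.
Proof.
move=> T0 TD Te x; have [s [c ->]] := e_span x.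
by elim/big_rec: _ => // b y _; apply: TD.
Qed.

Lemma basis_gr_ind (T : P -> Prop) n i :
  T 0 ->
  (forall k a x y i', i = i' + k%:Z -> ga_gr k a -> res_gr (n, i') x ->
    T x -> T y -> T (a *: x + y)) ->
  (forall b, (deg b).1 = n -> T (e b)) ->
  forall x, res_gr (n, i) x -> T x.
Proof.
move=> T0 TD Te x gx; have [s [c xE]] := e_span x.
rewrite -(hpart_id gP gx) xE hpart_sum.
elim/big_rec: _ => // b y _; move: (e_gr b) (Te b); case: (deg b) => n' i' gb Tb Ty.
have [a' [-> [->|[k [ak [en ei]]]]]] := act_part n i (c b) gb.
  by rewrite scale0r add0r.
by subst n'; apply: TD ei ak gb (Tb _) Ty.
Qed.

(** Coordinates are chosen as lists of pairs (basis element, coefficient). Freeness makes the value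
    independent of the list, and linearity follows by comparing lists. *)
Lemma free_extension (Q : lmodType A) (y : B -> Q) :
  exists f : {linear P -> Q}, forall b, f (e b) = y b.
Proof.
pose ev (W : lmodType A) (v : B -> W) (l : seq (B * A)) :=
  \sum_(p <- l) p.2 *: v p.1.
have ev_cat (W : lmodType A) (v : B -> W) l l' : ev W v (l ++ l') = ev W v l + ev W v l'.
  by rewrite /ev big_cat.
have ev_scale (W : lmodType A) (v : B -> W) a l :
    ev W v [seq (p.1, a * p.2) | p <- l] = a *: ev W v l.
  by rewrite /ev big_map scaler_sumr; apply: eq_bigr => p _; rewrite scalerA.
(* A list may repeat basis elements, so coefficients are collected before freeness is applied. *)
have ev0 l : ev P e l = 0 -> ev Q y l = 0.
  have evE (W : lmodType A) (v : B -> W) : ev W v l =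
      \sum_(b <- undup (map fst l)) (\sum_(p <- l | p.1 == b) p.2) *: v b.
    rewrite /ev (@sum_fibers _ _ _ fst l _ _ (undup_uniq (map fst l))) => [|b];
      last by rewrite mem_undup.
    apply: eq_bigr => b _; rewrite scaler_suml.
    by apply: eq_bigr => p /eqP ->.
  rewrite !evE => /(e_free (undup_uniq _)) h.
  by rewrite big1_seq // => b /= /h ->; rewrite scale0r.
have [|L LE] := @choice P (seq (B * A)) (fun x l => x = ev P e l).
  move=> x; have [s [c ->]] := e_span x.
  by exists [seq (b, c b) | b <- s]; rewrite /ev big_map.
have L_uniq x l : x = ev P e l -> ev Q y (L x) = ev Q y l.
  move=> xE; have := ev0 (L x ++ [seq (p.1, -1 * p.2) | p <- l]).
  rewrite !ev_cat !ev_scale -LE -xE scaleN1r subrr scaleN1r => /(_ erefl) /eqP.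
  by rewrite subr_eq0 => /eqP.
have linL : linear (fun x => ev Q y (L x)).
  move=> a u v; rewrite (L_uniq _ ([seq (p.1, a * p.2) | p <- L u] ++ L v)).
    by rewrite ev_cat ev_scale.
  by rewrite ev_cat ev_scale -!LE.
pose f : {linear P -> Q} :=
  HB.pack (fun x => ev Q y (L x)) (GRing.isLinear.Build _ _ _ _ _ linL).
exists f => b; rewrite /f /= (L_uniq _ [:: (b, 1)]) /ev big_seq1 ?scale1r //.
Qed.

(* Linear maps built degree by degree: the value on a generator is chosen in
   terms of the value already taken on its boundary. *)
Lemma recursive_linear (Q : lmodType A) (Rel : B -> Q -> Q -> Prop) :
  (forall (f : {linear P -> Q}) b,
     (forall c, (deg c).1 < (deg b).1 -> Rel c (f (res_d P (e c))) (f (e c))) ->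
     exists y, Rel b (f (res_d P (e b))) y) ->
  exists f : {linear P -> Q}, forall b, Rel b (f (res_d P (e b))) (f (e b)).
Proof.
move=> Rex.
(* One stage: outside homological degree [k] the values of [f] are kept, in degree [k] a value
   related to the boundary is taken whenever there is one. *)
pose upd (f : {linear P -> Q}) (k : nat) b y := ((deg b).1 != k%:Z -> y = f (e b)) /\
  ((deg b).1 = k%:Z -> (exists y, Rel b (f (res_d P (e b))) y) ->
     Rel b (f (res_d P (e b))) y).
have [|F FE] := @choice ({linear P -> Q} * nat) {linear P -> Q}
    (fun fk g => forall b, upd fk.1 fk.2 b (g (e b))).
  move=> -[f k]; have [|y yE] := @choice B Q (upd f k).
    move=> b; have [bk|bk] := eqVneq (deg b).1 k%:Z; last first.
      by exists (f (e b)); split=> // /eqP; rewrite (negPf bk).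
    have [[y Ry]|nR] := EM (exists y, Rel b (f (res_d P (e b))) y).
      by exists y; split=> [/eqP/(_ bk)|].
    by exists 0; split=> [/eqP/(_ bk)|_ /nR].
  have [g gE] := free_extension y.
  by exists g => b; rewrite /= gE.
pose G := fix G k := if k is k'.+1 then F (G k', k') else \0 : {linear P -> Q}.
have GS k b : (deg b).1 = k%:Z -> forall l, (k < l)%N -> G l (e b) = G k.+1 (e b).
  move=> bk; elim=> // l IH; rewrite ltnS leq_eqVlt => /orP[/eqP ->//|kl].
  rewrite -IH //; have [+ _] := FE (G l, l) b; apply.
  by rewrite bk eqz_nat neq_ltn kl.
(* Generators of degree [n] get their value at stage [n + 1] and later stages keep it, so the limit
   reads it there. *)
have [f fE] := free_extension (fun b => G `|(deg b).1|%N.+1 (e b)).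
have fG k b : (deg b).1 < k%:Z -> G k (e b) = f (e b).
  by move=> bk; have b0 := basis_neg b; rewrite fE; apply: GS; lia.
(* The boundary of [e b] lies one degree lower, where the stage numbered by the degree of [b] is
   already final. *)
have fdG b : f (res_d P (e b)) = G `|(deg b).1|%N (res_d P (e b)).
  have gd : res_gr ((deg b).1 - 1, (deg b).2) (res_d P (e b)).
    by apply: res_d_deg; rewrite -surjective_pairing.
  elim/basis_gr_ind: gd; first by rewrite !linear0.
    by move=> k a x y i' _ _ _; rewrite !linearP => -> ->.
  by move=> c cb; rewrite fG //; have := basis_neg b; lia.
exists f => b; have [k bk] : exists k : nat, (deg b).1 = k%:Z.
  by exists `|(deg b).1|%N; have := basis_neg b; lia.
elim/ltn_ind: k b bk => k IH b bk.
have fdb : f (res_d P (e b)) = G k (res_d P (e b)) by rewrite fdG bk.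
have [_ /(_ bk)] := FE (G k, k) b; rewrite /= -fdb -[F _]/(G k.+1) fG; last by lia.
apply; rewrite fdb; apply: Rex => c cb; rewrite fG -?bk //.
have cl : (`|(deg c).1| < k)%N by have := basis_neg c; lia.
suff <- : f (res_d P (e c)) = G k (res_d P (e c)).
  by apply: IH cl _ _; have := basis_neg c; lia.
have gd : res_gr ((deg c).1 - 1, (deg c).2) (res_d P (e c)).
  by apply: res_d_deg; rewrite -surjective_pairing.
elim/basis_gr_ind: gd; first by rewrite !linear0.
  by move=> l a x y i' _ _ _; rewrite !linearP => -> ->.
by move=> c' c'c; rewrite fG //; lia.
Qed.

End Basis.
End OneResolution.
End Resolutions.

(** * Lifting cocycles to chain maps, and null homotopies *)

Section Lifting.
Variables (K : fieldType) (A : gradedAlgebra K) (P Q : freeResolution A).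
Let gQ := res_graded Q.

Definition shifts (p j : int) (f : P -> Q) : Prop :=
  forall n i x, res_gr (n, i) x -> res_gr (n - p, i - j) (f x).

(** The comparison theorem with a shift of degree, by recursion on generators: zero below degree
    [p], a preimage under the augmentation in degree [p], exactness of [Q] above. *)
Lemma lift_cocycle p j (phi : P -> K) : triv_cocycle p j phi ->
  exists f : {linear P -> Q},
    [/\ shifts p j f, forall x, res_d Q (f x) = ksign A p *: f (res_d P x)
      & forall x, res_eps (f x) = phi x].
Proof.
move=> [[phiL phi0] phid].
have [epsL eps0] := res_eps_hom Q.
have k_phi := triv_linear_klinear phiL; have k_eps := triv_linear_klinear epsL.
have [B [deg [e [e_gr e_span e_free]]]] := res_free P.
pose Rel b (q y : Q) :=
  [/\ res_gr ((deg b).1 - p, (deg b).2 - j) y, res_d Q y = ksign A p *: q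
    & (deg b).1 = p -> res_eps y = phi (e b)].
have grad (f : {linear P -> Q}) n :
    (forall c, (deg c).1 = n -> Rel c (f (res_d P (e c))) (f (e c))) ->
  forall i x, res_gr (n, i) x -> [/\ res_gr (n - p, i - j) (f x),
    res_d Q (f x) = ksign A p *: f (res_d P x) & n = p -> res_eps (f x) = phi x].
  move=> fR i x gx; split.
  - rewrite -(hpart_id (res_graded P) gx); have [s [c ->]] := e_span x.
    rewrite hpart_sum linear_sum; apply: (gr_sum gQ) => b _.
    have := e_gr b; case db : (deg b) => [n' i'] gb.
    have [a' [-> [->|[k [ak [en ei]]]]]] := act_part n i (c b) gb.
      by rewrite scale0r linear0; apply: (gr0 gQ).
    have [|gf _ _] := fR b; first by rewrite db -en.
    rewrite linearZ ei addrAC /=; apply: res_act => //.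
    by move: gf; rewrite db /= -en.
  - elim/(basis_gr_ind e_gr e_span): gx; first by rewrite !linear0 scaler0.
      move=> k a y z i' _ _ _ IHy IHz; rewrite !linearP /= IHy IHz.
      by rewrite scalerDr !scalerA ksignC.
    by move=> b bn; case: (fR b bn).
  - move=> np; elim/(basis_gr_ind e_gr e_span): gx.
    + by rewrite linear0 (klinear0 k_phi) (klinear0 k_eps).
    + move=> k a y z i' _ _ _ IHy IHz; have [c cE] := augmentation a.
      by rewrite linearP /= (proj1 k_eps) (proj1 k_phi) !cE // IHy IHz.
    + by move=> b bn; case: (fR b bn) => _ _; apply; rewrite bn.
have [f b|f fR] := recursive_linear e_gr e_span e_free (Rel := Rel).
  move=> IH; have := e_gr b; case db : (deg b) => [n i] gb.
  have gdb := res_d_deg gb.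
  have [|gq dq eq] := grad f (n - 1) _ i _ gdb.
    by move=> c cn; apply: IH; rewrite db cn /=; lia.
  set q := f _ in gq dq eq *; rewrite /Rel db /=.
  have [np|pn|np] := ltgtP n p.
  - exists 0; rewrite linear0; split; [exact: (gr0 gQ) | | lia].
    by rewrite (res_neg _ gq) ?scaler0 //; lia.
  (* Just above degree [p], exactness at [Q_0] asks for zero augmentation, which is the cocycle
     condition on [phi]. Higher up it asks for a cycle. *)
  - have [np1|np1] := eqVneq n (p + 1).
      have eps_q : res_eps (ksign A p *: q) = 0.
        have [c ->] := augmentation (ksign A p); last exact: epsL.
        by rewrite eq ?phid ?mulr0 //; lia.
      have gq0 : res_gr (0, i - j) (ksign A p *: q).
        by apply: ksign_gr; rewrite (_ : 0 = n - 1 - p) //; lia.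
      have /(res_exact0 gq0)[y gy dy] := eps_q.
      exists y; split=> //; last by lia.
      by rewrite (_ : n - p = 1) //; lia.
    have np0 : 0 < n - 1 - p by lia.
    have /(res_exact np0 (ksign_gr p gq))[y gy dy] : res_d Q (ksign A p *: q) = 0.
      by rewrite linearZ /= dq res_dd linear0 !scaler0.
    by exists y; split=> //; [rewrite (_ : n - p = n - 1 - p + 1) //; lia | lia].
  - have q0 : q = 0 by apply: res_neg gq; lia.
    rewrite q0 scaler0 np subrr.
    (* Off internal degree [j], [phi] vanishes on [e b] and 0 is a valid value. *)
    have [ij|ij] := eqVneq i j; last first.
      exists 0; rewrite linear0; split=> [||_]; [exact: (gr0 gQ) | by [] |].
      by rewrite (klinear0 k_eps) (phi0 _ _ gb) // np xpair_eqE eqxx.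
    have [y gy ey] := res_eps_onto Q (phi (e b)).
    exists y; rewrite ij subrr; split=> //.
    by apply: res_neg (res_d_deg gy); lia.
have gradf n i x : res_gr (n, i) x -> [/\ res_gr (n - p, i - j) (f x),
    res_d Q (f x) = ksign A p *: f (res_d P x) & n = p -> res_eps (f x) = phi x].
  exact: grad.
exists f; split; first by move=> n i x /gradf[].
  elim/(basis_ind e_span) => [|a x y IHx IHy|b]; last by case: (fR b).
    by rewrite !linear0 scaler0.
  by rewrite !linearP /= IHx IHy scalerDr !scalerA ksignC.
move=> x; have [s _ ->] := hpart_supp (res_graded P) x.
rewrite linear_sum (klinear_sum _ _ _ k_eps) (klinear_sum _ _ _ k_phi).
apply: eq_bigr => -[n i] _; have gx := hpart_gr (res_graded P) (n, i) x.
have [gf _ ef] := gradf _ _ _ gx; have [/ef //|/eqP np] := EM (n = p).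
rewrite (eps0 _ _ gf) ?(phi0 _ _ gx) // xpair_eqE ?subr_eq0 negb_and np //.
Qed.

Lemma null_homotopy (g : {linear P -> Q}) :
    shifts 0 0 g -> (forall x, res_d Q (g x) = g (res_d P x)) ->
    (forall x, res_eps (g x) = 0) ->
  exists h : {linear P -> Q},
    shifts (-1) 0 h /\ forall x, g x = res_d Q (h x) + h (res_d P x).
Proof.
move=> g_gr gd geps.
have [B [deg [e [e_gr e_span e_free]]]] := res_free P.
pose Rel b (q y : Q) :=
  res_gr ((deg b).1 + 1, (deg b).2) y /\ res_d Q y = g (e b) - q.
have grad (f : {linear P -> Q}) n :
    (forall c, (deg c).1 = n -> Rel c (f (res_d P (e c))) (f (e c))) ->
  forall i x, res_gr (n, i) x -> res_gr (n + 1, i) (f x) /\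
    g x = res_d Q (f x) + f (res_d P x).
  move=> fR i x gx; split.
  - rewrite -(hpart_id (res_graded P) gx); have [s [c ->]] := e_span x.
    rewrite hpart_sum linear_sum; apply: (gr_sum gQ) => b _.
    have := e_gr b; case db : (deg b) => [n' i'] gb.
    have [a' [-> [->|[k [ak [en ei]]]]]] := act_part n i (c b) gb.
      by rewrite scale0r linear0; apply: (gr0 gQ).
    have [|gf _] := fR b; first by rewrite db -en.
    rewrite linearZ ei /=; apply: res_act => //.
    by move: gf; rewrite db /= -en.
  - elim/(basis_gr_ind e_gr e_span): gx; first by rewrite !linear0 addr0.
      move=> k a y z i' _ _ _ IHy IHz; rewrite !linearP /= IHy IHz.
      by rewrite scalerDr addrACA.
    by move=> b bn; case: (fR b bn) => _ ->; rewrite subrK.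
have [f b|f fR] := recursive_linear e_gr e_span e_free (Rel := Rel).
  move=> IH; have := e_gr b; case db : (deg b) => [n i] gb.
  have gdb := res_d_deg gb.
  have [|gq gE] := grad f (n - 1) _ i _ gdb.
    by move=> c cn; apply: IH; rewrite db cn /=; lia.
  set q := f _ in gq gE *; rewrite /Rel db /=.
  have gz : res_gr (n, i) (g (e b) - q).
    apply: (grB gQ); last by rewrite subrK in gq.
    by have := g_gr _ _ _ gb; rewrite !subr0.
  have n0 : 0 <= n by have := basis_neg e_gr e_free b; rewrite db.
  (* In degree 0 the boundary of [e b] is zero, and vanishing augmentation takes the place of the
     cycle condition. *)
  have [n0'|n0'] := eqVneq n 0.
    have db0 : res_d P (e b) = 0 by apply: res_neg gdb; lia.
    rewrite n0' in gz *; have /(res_exact0 gz)[y gy dy] : res_eps (g (e b) - q) = 0.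
      by rewrite /q db0 linear0 subr0.
    by exists y.
  have n1 : 0 < n by lia.
  have /(res_exact n1 gz)[y gy dy] : res_d Q (g (e b) - q) = 0.
    by rewrite linearB /= gd gE res_dd linear0 addr0 subrr.
  by exists y.
exists f; split.
  by move=> n i x gx; rewrite opprK subr0; case: (@grad f n (fun c _ => fR c) i x gx).
elim/(basis_ind e_span) => [|a x y IHx IHy|b].
- by rewrite !linear0 addr0.
- by rewrite !linearP /= IHx IHy scalerDr addrACA.
- by case: (fR b) => _ ->; rewrite subrK.
Qed.

End Lifting.

(** * The bigraded Ext space of a bi-Koszul algebra *)

Section Cocycles.
Variables (K : fieldType) (A : gradedAlgebra K).

Lemma triv_hom_comp (P Q : freeResolution A) (f : {linear P -> Q}) p j q l phi :
  shifts q l f -> triv_hom (@res_gr K A Q) p j phi ->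
  triv_hom (@res_gr K A P) (p + q) (j + l) (phi \o f).
Proof.
move=> f_gr [phiL phi0]; split; first exact: triv_comp.
move=> [n i] x gx ne; apply: phi0 (f_gr _ _ _ gx) _.
by apply: contra ne; rewrite !xpair_eqE !subr_eq.
Qed.

Lemma triv_cocycle_comp (P Q : freeResolution A) (f : {linear P -> Q}) p j q l phi :
  shifts q l f -> (forall x, res_d Q (f x) = ksign A q *: f (res_d P x)) ->
  @triv_cocycle K A Q p j phi -> @triv_cocycle K A P (p + q) (j + l) (phi \o f).
Proof.
move=> f_gr fd [hphi phid]; split; first exact: triv_hom_comp.
move=> x /=; have [c cE] := augmentation (ksign A q).
rewrite -[f _]scale1r -(ksignK A q) -scalerA -fd cE ?phid ?mulr0 //.
by case: hphi.
Qed.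

Lemma eps_cocycle (P : freeResolution A) : triv_cocycle 0 0 (@res_eps K A P).
Proof. by split; [apply: res_eps_hom | apply: res_eps_d]. Qed.

Lemma triv_hom0 (P : freeResolution A) p j : triv_hom (@res_gr K A P) p j (fun=> 0).
Proof. by split=> //; split=> *; rewrite ?addr0 ?mulr0. Qed.

Lemma triv_hom_lin (P : freeResolution A) p j a phi psi :
  triv_hom (@res_gr K A P) p j phi -> triv_hom (@res_gr K A P) p j psi ->
  triv_hom (@res_gr K A P) p j (fun x => a * phi x + psi x).
Proof.
move=> [[phiD phiZ phiJ] phi0] [[psiD psiZ psiJ] psi0]; split.
  split=> [x y|c x|k b x k0 bk].
  - by rewrite phiD psiD mulrDr addrACA.
  - by rewrite phiZ psiZ mulrDr mulrCA.
  - by rewrite (phiJ k) ?(psiJ k) ?mulr0 ?addr0.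
by move=> ni x gx ne; rewrite (phi0 ni) ?(psi0 ni) ?mulr0 ?addr0.
Qed.

Lemma triv_cocycle_lin (P : freeResolution A) p j a phi psi :
  @triv_cocycle K A P p j phi -> @triv_cocycle K A P p j psi ->
  @triv_cocycle K A P p j (fun x => a * phi x + psi x).
Proof.
move=> [hphi phid] [hpsi psid]; split; first exact: triv_hom_lin.
by move=> x; rewrite phid psid mulr0 addr0.
Qed.

Lemma triv_cocycle0 (P : freeResolution A) p j : @triv_cocycle K A P p j (fun=> 0).
Proof. by split=> //; apply: triv_hom0. Qed.

Lemma triv_cocycle_sum (P : freeResolution A) p j r (phi : 'I_r -> P -> K) :
  (forall i, triv_cocycle p j (phi i)) ->
  triv_cocycle p j (fun x => \sum_(i < r) phi i x).
Proof.
move=> cphi; elim: r phi cphi => [|r IH] phi cphi.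
  by under eq_fun do rewrite big_ord0; apply: triv_cocycle0.
under eq_fun do rewrite big_ord_recl -[phi _ _]mul1r.
by apply: triv_cocycle_lin => //; apply: IH.
Qed.

Section Classes.
Variables (P : freeResolution A) (E : extSpace P).

Lemma ext_cls_eq p j (phi psi rho : P -> K) :
  triv_cocycle p j phi -> triv_cocycle p j psi ->
  triv_hom (@res_gr K A P) (p - 1) j rho ->
  (forall x, phi x = psi x + rho (res_d P x)) -> ext_cls E phi = ext_cls E psi.
Proof.
move=> cphi cpsi hrho eq_rho; apply/eqP; rewrite -subr_eq0 addrC -scaleN1r.
rewrite -(ext_cls_lin _ _ cpsi cphi); apply/eqP.
apply/(ext_cls_ker _ (triv_cocycle_lin _ cpsi cphi)); exists rho => // x.
by rewrite eq_rho mulN1r addrA addNr add0r.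
Qed.

Lemma ext_cls0 : ext_cls E (fun=> 0) = 0.
Proof.
apply/(ext_cls_ker _ (triv_cocycle0 P 0 0)).
by exists (fun=> 0); [apply: triv_hom0 | ].
Qed.

Lemma ext_cls_sum p j r (phi : 'I_r -> P -> K) :
  (forall i, triv_cocycle p j (phi i)) ->
  ext_cls E (fun x => \sum_(i < r) phi i x) = \sum_(i < r) ext_cls E (phi i).
Proof.
elim: r phi => [|r IH] phi cphi.
  by under eq_fun do rewrite big_ord0; rewrite ext_cls0 big_ord0.
under eq_fun do rewrite big_ord_recl -[phi _ _]mul1r.
rewrite (ext_cls_lin _ _ (cphi _) (triv_cocycle_sum _)) // scale1r big_ord_recl.
by rewrite IH.
Qed.

Variable P' : freeResolution A.

(** Both maps lift the augmentation, so [beta \o alpha] differs from the identity by a homotopy [h],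
    and [phi \o h] bounds the difference of the two cocycles. Classes on [P] can thus be represented
    through [P']. *)
Lemma comparison : exists (alpha : {linear P -> P'}) (beta : {linear P' -> P}),
  [/\ shifts 0 0 alpha, shifts 0 0 beta,
      (forall x, res_d P' (alpha x) = alpha (res_d P x)),
      (forall x, res_d P (beta x) = beta (res_d P' x)) &
      (forall x, res_eps (alpha x) = res_eps x) /\
      forall p j phi, triv_cocycle p j phi ->
        ext_cls E phi = ext_cls E (phi \o beta \o alpha)].
Proof.
have ks0 (Q R : freeResolution A) (f : {linear Q -> R}) :
    (forall x, res_d R (f x) = ksign A 0 *: f (res_d Q x)) ->
  forall x, res_d R (f x) = f (res_d Q x) by move=> h x; rewrite h scale1r.
have [alpha [a_gr ad ae]] := lift_cocycle P' (eps_cocycle P).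
have [beta [b_gr bd be]] := lift_cocycle P (eps_cocycle P').
exists alpha, beta; split=> //; [exact: ks0 | exact: ks0 | split=> //].
move=> p j phi cphi.
pose g : {linear P -> P} := (beta \o alpha) \- idfun.
have gE x : g x = beta (alpha x) - x by [].
have [n i x gx|x|x|h [h_gr hE]] := @null_homotopy _ _ _ _ g.
- rewrite gE; apply: (grB (res_graded P)); last by rewrite !subr0.
  by have := b_gr _ _ _ (a_gr _ _ _ gx); rewrite !subr0.
- by rewrite !gE linearB /= (ks0 _ _ _ bd) (ks0 _ _ _ ad).
- rewrite gE; have [ed ez ej] := proj1 (res_eps_hom P).
  by rewrite ed -scaleN1r -[-1]scaleN1r ez be ae mulN1r subrr.
have [hphi phid] := cphi; have [[phiD phiZ phiJ] _] := hphi.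
symmetry; apply: (ext_cls_eq (p := p) (j := j) (rho := phi \o h)) => //.
- have := triv_cocycle_comp a_gr ad (triv_cocycle_comp b_gr bd cphi).
  by rewrite !addr0.
- by have := triv_hom_comp h_gr hphi; rewrite addr0.
move=> x /=; have := hE x; rewrite gE => /eqP; rewrite subr_eq => /eqP ->.
by rewrite !phiD phid add0r addrC.
Qed.

End Classes.
End Cocycles.

Lemma Delta0 d k : Delta d (3 * k) = (2 * d * k, 2 * d * k)%N.
Proof. by rewrite /Delta modnMr mulKn. Qed.

Lemma Delta1 d k : Delta d (3 * k + 1) = (2 * d * k + 1, 2 * d * k + 1)%N.
Proof. by rewrite /Delta mulnC modnMDl divnMDl // addn0. Qed.

Lemma Delta2 d k : Delta d (3 * k + 2) = (2 * d * k + d, 2 * d * k + d + 1)%N.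
Proof. by rewrite /Delta mulnC modnMDl divnMDl // addn0. Qed.

Lemma Delta_le d n : ((Delta d n).1 <= (Delta d n).2)%N.
Proof. by rewrite /Delta; case: (n %% 3)%N => [|[|r]] //=; rewrite leq_addr. Qed.

Definition Delta_support (d : nat) (pj : int * int) : Prop :=
  exists2 n : nat, pj.1 = n%:Z & pj.2 = (Delta d n).1%:Z \/ pj.2 = (Delta d n).2%:Z.

(** * Resolutions generated in the degrees [Delta d] *)

Section DeltaGenerated.
Variables (K : fieldType) (A : gradedAlgebra K) (d : nat) (Q : freeResolution A).
Hypothesis genQ : generated_in_Delta d Q.
Let gQ := res_graded Q.

(** By [act_part] the component of each summand is again a multiple of the same generator, so the
    coefficients can be made homogeneous. *)
Lemma Delta_decomp (n : nat) i (x : Q) : res_gr (n%:Z, i) x ->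
  exists (r : nat) (a : 'I_r -> A) (y : 'I_r -> Q), x = \sum_(l < r) a l *: y l /\
    forall l, a l = 0 \/ exists (k j : nat),
      [/\ j = (Delta d n).1 \/ j = (Delta d n).2, res_gr (n%:Z, j%:Z) (y l),
          ga_gr k (a l) & i = j%:Z + k%:Z].
Proof.
move=> gx; have [r [a [y [gy xE]]]] := genQ gx.
have [|a' aE] := @choice 'I_r A (fun l a' =>
    hpart gQ (n%:Z, i) (a l *: y l) = a' *: y l /\
    (a' = 0 \/ exists (k j : nat),
      [/\ j = (Delta d n).1 \/ j = (Delta d n).2, res_gr (n%:Z, j%:Z) (y l),
          ga_gr k a' & i = j%:Z + k%:Z])).
  move=> l; have [j [jD gyl]] : exists j : nat,
      (j = (Delta d n).1 \/ j = (Delta d n).2) /\ res_gr (n%:Z, j%:Z) (y l).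
    by case: (gy l) => h; eexists; split; try exact: h; [left | right].
  have [a' [aE h]] := act_part n i (a l) gyl; exists a'; split=> //.
  by case: h => [->|[k [ak [ei]]]]; [left | right; exists k, j].
exists r, a', y; split=> [|l]; last by case: (aE l).
rewrite -(hpart_id gQ gx) xE hpart_sum; apply: eq_bigr => l _.
by case: (aE l).
Qed.

Lemma Delta_low (n : nat) i (x : Q) :
  res_gr (n%:Z, i) x -> i < (Delta d n).1%:Z -> x = 0.
Proof.
move=> gx lt_i; have [r [a [y [-> h]]]] := Delta_decomp gx.
rewrite big1 // => l _; case: (h l) => [->|[k [j [jD _ _ ei]]]].
  by rewrite scale0r.
by have := Delta_le d n; case: jD => jD; lia.
Qed.

Lemma triv_hom_Delta p j phi (x : Q) :
  triv_hom (@res_gr K A Q) p j phi -> ~ Delta_support d (p, j) -> phi x = 0.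
Proof.
move=> hphi nD; apply: (triv_homE hphi (triv_hom0 Q p j)) => {}x gx.
have [phiL phi0] := hphi; have kphi := triv_linear_klinear phiL.
have [p0|p0] := ltP p 0; first by rewrite (res_neg p0 gx) (klinear0 kphi).
case: p p0 gx nD hphi phi0 => // n _ gx nD _ phi0.
have [r [a [y [-> h]]]] := Delta_decomp gx.
rewrite (klinear_sum _ _ _ kphi) big1 // => l _.
case: (h l) => [->|[k [i [iD gy _ ei]]]]; first by rewrite scale0r (klinear0 kphi).
have [c -> //] := augmentation (a l); rewrite (phi0 _ _ gy) ?mulr0 //.
apply/eqP => -[ij]; apply: nD.
by exists n => //=; rewrite -ij; case: iD => ->; [left | right].
Qed.

(** Nothing lies below the bottom degree, so no element there is a positive-degree multiple; every
    functional on it therefore respects the trivial module structure. *)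
Lemma bottom_functional (n : nat) (theta : Q -> K) : klinear theta ->
  triv_hom (@res_gr K A Q) n (Delta d n).1%:Z
    (fun x => theta (hpart gQ (n%:Z, (Delta d n).1%:Z) x)).
Proof.
move=> kt; have [tD tZ] := kt; split.
  split=> [x y|c x|k a x k0 ak].
  - by rewrite hpartD tD.
  - rewrite -tZ; congr theta.
    have := @hpart_act _ _ Q 0 c%:A n%:Z (Delta d n).1%:Z x; rewrite addr0; apply.
    by apply/ga_connected; exists c.
  - rewrite -[(Delta d n).1%:Z](subrK k%:Z) hpart_act //.
    by rewrite (Delta_low (hpart_gr gQ _ _)) ?scaler0 ?(klinear0 kt) //; lia.
by move=> [n' i] x gx ne; rewrite (hpart_ne gQ gx ne) (klinear0 kt).
Qed.

(** An element of the bottom degree is a scalar combination of basis elements, and freeness forbids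
    a non-zero [a] to kill a non-zero combination of this kind. *)
Lemma Delta_faithful (n : nat) (x : Q) (a : A) :
  res_gr (n%:Z, (Delta d n).1%:Z) x -> x <> 0 -> a *: x = 0 -> a = 0.
Proof.
move=> gx x0; have [B [deg [e [e_gr e_span e_free]]]] := res_free Q.
(* A coefficient of positive degree would put [e b] below the bottom degree, where [Q] is zero. *)
have [|t tE] := @choice (B * A) K (fun bc t =>
    hpart gQ (n%:Z, (Delta d n).1%:Z) (bc.2 *: e bc.1) = t%:A *: e bc.1).
  move=> [b c] /=; have := e_gr b; case db : (deg b) => [n' i] gb.
  have [a' [-> [->|[k [ak [en ei]]]]]] := act_part n%:Z (Delta d n).1%:Z c gb.
    by exists 0; rewrite !scale0r.
  subst n'; case: k ak ei => [|k] ak ei.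
    by have [t ->] := (ga_connected a').1 ak; exists t.
  by exists 0; rewrite (Delta_low gb) ?scaler0 //; lia.
have [s [c xE]] := e_span x.
have {}xE : x = \sum_(b <- s) (t (b, c b))%:A *: e b.
  rewrite -(hpart_id gQ gx) xE hpart_sum; apply: eq_bigr => b _.
  exact: (tE (b, c b)).
pose u b := \sum_(b' <- s | b' == b) t (b', c b').
have {}xE : x = \sum_(b <- undup s) (u b)%:A *: e b.
  rewrite xE (@sum_fibers _ _ _ id s _ _ (undup_uniq s)); last first.
    by rewrite map_id => b; rewrite mem_undup.
  apply: eq_bigr => b _; rewrite !scaler_suml.
  by apply: eq_bigr => b' /eqP ->.
rewrite xE scaler_sumr => ax0; apply: contrapT => a0; apply: x0.
rewrite xE big1_seq // => b /= bs.
have : a * (u b)%:A = 0.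
  apply: (e_free (undup s) (fun b => a * (u b)%:A) (undup_uniq s)) => //.
  by rewrite -[RHS]ax0; apply: eq_bigr => b' _; rewrite scalerA.
rewrite mulr_algr => /eqP; rewrite scaler_eq0 => /orP[/eqP ->|/eqP //].
by rewrite !scale0r.
Qed.
End DeltaGenerated.

Lemma degree_one_duals (K : fieldType) (A : gradedAlgebra K) :
  exists (r : nat) (b : 'I_r -> A) (a : 'I_r -> A -> K),
    [/\ forall l, ga_gr 1 (b l),
        forall l x y, a l (x + y) = a l x + a l y,
        forall l c x, a l (c *: x) = c * a l x &
        forall x, ga_gr 1 x -> x = \sum_(l < r) a l x *: b l].
Proof.
have [r [b [b1 b_span]]] := ga_locally_finite A 1.
(* [dual_family] is indexed by all naturals; [b'] extends [b] by 0 and lives in [A] as a module over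
   itself. *)
pose b' i : A^o := oapp b 0 (insub i).
have b'E (l : 'I_r) : b' l = b l by rewrite /b' valK.
have [a ka aE] := dual_family b' r.
have scE (c : K) (x : A) : (c%:A : A) *: (x : A^o) = c *: x :> A.
by rewrite -[LHS]/((c%:A : A) * x) mulr_algl.
exists r, b, (fun l x => a l x); split.
- by [].
- by move=> l x y; exact: (proj1 (ka l)).
- by move=> l c x; rewrite -scE; exact: (proj2 (ka l)).
move=> x gx.
have [c xE] := b_span x gx.
rewrite {1}(aE (fun i => oapp c 0 (insub i)) x).
  by apply: eq_bigr => l _; rewrite scE b'E.
by rewrite xE; apply: eq_bigr => l _; rewrite scE b'E valK.
Qed.

(** * Support of the Ext space and generation of its first row *)

Section ExtOfBiKoszul.
Variables (K : fieldType) (A : gradedAlgebra K) (d : nat).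
Variables (P : freeResolution A) (E : extSpace P).

Lemma ext_support p j (x : E) :
  bi_Koszul A d -> ext_gr (p, j) x -> x <> 0 -> Delta_support d (p, j).
Proof.
move=> [P' [_ genP']] gx; apply: contra_notP => nD.
have [phi cphi <-] := ext_cls_onto gx.
have [alpha [beta [_ b_gr _ _ [_ clsE]]]] := comparison E P'.
rewrite (clsE _ _ _ cphi) -(ext_cls0 E); congr ext_cls; apply/funext => y /=.
have := triv_hom_comp b_gr (proj1 cphi); rewrite !addr0 => h.
exact: (@triv_hom_Delta _ _ _ _ genP' _ _ _ (alpha y) h nD).
Qed.

(* With [P'] generated in the degrees [Delta d], the boundary embeds the bottom
   degree of [P'_{3k+1}] into [A_1 (P'_{3k})], because [P'_{3k+2}] starts only in
   degree [2dk + d].  A cocycle on [P'_{3k+1}] is thus a functional on a subspace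
   of [A_1 (P'_{3k})], extends to the whole of it, and decomposes there along a
   dual family of [A_1]; the decomposition is a sum of Yoneda products. *)
Lemma ext_generation (m : seq E -> E) k (x : E) : (2 <= d)%N -> bi_Koszul A d ->
  (forall p j q l (z w : P -> P), chain_endo p j z -> chain_endo q l w ->
    m [:: ext_class E z; ext_class E w] = ext_class E (z \o w)) ->
  ext_gr ((3 * k + 1)%N%:Z, (2 * d * k + 1)%N%:Z) x ->
  exists (r : nat) (y z : 'I_r -> E),
    (forall l, ext_gr (1, 1) (y l) /\
       ext_gr ((3 * k)%N%:Z, (2 * d * k)%N%:Z) (z l)) /\
    exists s : K, x = s *: \sum_(l < r) m [:: y l; z l].
Proof.
move=> d2 [P' [_ genP']] mY gx; pose gP' := res_graded P'.
set n := (3 * k)%N in gx *; set j := (2 * d * k)%N in gx *.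
have Dn : (Delta d n).1 = j by rewrite Delta0.
have Dn1 : (Delta d (n + 1)).1 = (j + 1)%N by rewrite Delta1.
have Dn2 : (Delta d (n + 2)).1 = (j + d)%N by rewrite Delta2.
have D1 : (Delta d 1).1 = 1%N by rewrite -[1%N]/(3 * 0 + 1)%N Delta1 /= muln0.
have [phi cphi <-] := ext_cls_onto gx.
have [alpha [beta [a_gr b_gr ad bd [ae clsE]]]] := comparison E P'.
rewrite (clsE _ _ _ cphi); set phi' := phi \o beta.
have hphi' : triv_hom (@res_gr K A P') (n + 1)%N%:Z (j + 1)%N%:Z phi'.
  by have := triv_hom_comp b_gr (proj1 cphi); rewrite !addr0.
have kphi' : klinear phi' by apply: triv_linear_klinear; case: hphi'.
have d_inj (y : P') : res_gr ((n + 1)%N%:Z, (j + 1)%N%:Z) y -> res_d P' y = 0 -> y = 0.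
  move=> gy /(res_exact _ gy)[|z gz <-]; first by lia.
  rewrite (Delta_low genP' (n := n + 2) (i := (j + 1)%N%:Z) (x := z)) ?linear0 //.
    by rewrite (_ : (n + 2)%N%:Z = (n + 1)%N%:Z + 1) //; lia.
  by rewrite Dn2; lia.
(* [lam] extends the functional sending [res_d P' y] to [phi' y], which is well defined by
   [d_inj]. *)
have [||c [y gy [/esym/(d_inj _ gy) -> ->]]|lam klam lamE] := @klinear_extension K A P'
    (fun v c => exists2 y, res_gr ((n + 1)%N%:Z, (j + 1)%N%:Z) y &
       v = res_d P' y /\ c = phi' y).
- by exists 0; [apply: (gr0 gP') | rewrite linear0 (klinear0 kphi')].
- move=> a _ c _ c' [y gy [-> ->]] [y' gy' [-> ->]]; exists (a%:A *: y + y').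
    by apply: (grD gP') => //; apply: scalar_gr.
  by rewrite linearP (proj1 kphi') (proj2 kphi').
- by rewrite (klinear0 kphi').
(* [P'_1] starts in degree 1, so the augmentation is injective on bidegree (0, 0), which is the line
   through [e0]. *)
have [e0 ge0 ee0] := res_eps_onto P' 1.
have [epsL eps0] := res_eps_hom P'; have keps := triv_linear_klinear epsL.
have e0_neq0 : e0 <> 0.
  by move=> e00; move/eqP: ee0; rewrite e00 (klinear0 keps) eq_sym oner_eq0.
have e0_free (a : A) : a *: e0 = 0 -> a = 0.
  by apply: (Delta_faithful genP' (n := 0%N)) => //; rewrite (Delta0 d 0) muln0.
have e0_span (y : P') : res_gr (0, 0) y -> y = (res_eps y)%:A *: e0.
  move=> gy; apply/eqP; rewrite -subr_eq0; apply/eqP.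
  have gz : res_gr (0, 0) (y - (res_eps y)%:A *: e0).
    by apply: (grB gP') => //; apply: scalar_gr.
  have /(res_exact0 gz)[z gz1 <-] : res_eps (y - (res_eps y)%:A *: e0) = 0.
    rewrite (proj1 keps) -scaleN1r -[-1]scaleN1r !(proj2 keps) ee0 mulr1 mulN1r.
    exact: subrr.
  by rewrite (Delta_low genP' (n := 1) gz1) ?linear0 // D1.
have [r [b [a [b1 aD aZ aE]]]] := degree_one_duals A.
(* [A_1] embeds into [P'_0] by [c |-> c *: e0], and [chi l] reads the coordinate [a l] on the
   image. *)
have chi_ex l : exists chi : P' -> K, klinear chi /\
    forall c, ga_gr 1 c -> chi (c *: e0) = a l c.
  have a0 : a l 0 = 0 by have := aZ l 0 0; rewrite scale0r mul0r.
  have gA : internal_grading (@whole A) (@ga_gr K A) by case: (ga_graded A).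
  have [||c [y gy [/esym/e0_free -> ->]]|chi kchi chiE] := @klinear_extension K A P'
    (fun v c => exists2 y, ga_gr 1 y & v = y *: e0 /\ c = a l y) => //.
  - by exists 0; [apply: (gr0 gA) | rewrite scale0r a0].
  - move=> t _ c _ c' [y gy [-> ->]] [y' gy' [-> ->]]; exists (t *: y + y').
      by apply: (grD gA) => //; case: (ga_graded A) => _ _; apply.
    by rewrite scalerDl scalerA mulr_algl aD aZ.
  by exists chi; split=> // c gc; apply: chiE; exists c.
have [chi chiE] := choice chi_ex.
(* The factor in E^1: the [l]-th coordinate of the boundary. *)
pose psi l y := chi l (res_d P' (hpart gP' (1%N%:Z, 1%N%:Z) y)).
have cpsi l : triv_cocycle 1 1 (psi l).
  have [kc _] := chiE l; split.
    have kt : klinear (chi l \o res_d P').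
      by split=> [y z|c y] /=; rewrite ?linearD ?linearZ /= ?(proj1 kc) ?(proj2 kc).
    by have := bottom_functional genP' 1 kt; rewrite D1.
  move=> y; rewrite /psi (_ : hpart gP' (1%N%:Z, 1%N%:Z) _ = res_d P' (hpart gP' (2, 1) y)).
    by rewrite res_dd (klinear0 kc).
  exact: (hpart_d 2 1 y).
pose eta l y := lam (b l *: hpart gP' (n%:Z, j%:Z) y).
have ceta l : triv_cocycle n%:Z j%:Z (eta l).
  split.
    have kt : klinear (lam \o *:%R (b l)).
      split=> [y z|c y] /=; first by rewrite scalerDr (proj1 klam).
      by rewrite scalerA mulr_algr -mulr_algl -scalerA (proj2 klam).
    by have := bottom_functional genP' n kt; rewrite Dn.
  move=> y; rewrite /eta; have := hpart_d (n%:Z + 1) j%:Z y; rewrite addrK => ->.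
  have -> : hpart gP' (n%:Z + 1, j%:Z) y = 0.
    apply: (Delta_low genP' (n := n + 1) (i := j%:Z)); last by rewrite Dn1; lia.
    exact: (hpart_gr gP' (n%:Z + 1, j%:Z)).
  by rewrite linear0 scaler0 (klinear0 klam).
have [w wE] := choice (fun l => lift_cocycle P (ceta l)).
have eta_w l v : res_gr (n%:Z, j%:Z) v -> alpha (w l v) = (lam (b l *: v))%:A *: e0.
  move=> gv; have [w_gr _ we] := wE l.
  rewrite (e0_span (alpha (w l v))); last first.
    by have := a_gr _ _ _ (w_gr _ _ _ gv); rewrite !subr0 !subrr.
  by rewrite ae we /eta hpart_id.
(* Expand [c] along the [b l]. Since [alpha \o w l] sends [v] to [lam (b l *: v)] times [e0],
   [chi l] reads off [a l c * lam (b l *: v)]. *)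
have lam_sum c v : ga_gr 1 c -> res_gr (n%:Z, j%:Z) v ->
    lam (c *: v) = \sum_(l < r) chi l (alpha (w l (c *: v))).
  move=> gc gv; rewrite {1}(aE c gc) scaler_suml (klinear_sum _ _ _ klam).
  apply: eq_bigr => l _; have [kc chi_e0] := chiE l.
  rewrite !linearZ /= eta_w // scalerA mulr_algr -[_ *: c]mulr_algl -scalerA (proj2 kc).
  by rewrite chi_e0 // -mulr_algl -scalerA (proj2 klam) mulrC.
(* The sign comes from moving the differential past [w l], which has cohomological degree [n]. *)
have phi'E y : phi' y = ksign K n%:Z * (\sum_(l < r) psi l (alpha (w l y))) + 0.
  have cpsiw l : @triv_cocycle K A P' (n + 1)%N%:Z (j + 1)%N%:Z
      (fun y => psi l (alpha (w l y))).
    have [w_gr wd _] := wE l.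
    have ca := triv_cocycle_comp (f := alpha) a_gr _ (cpsi l).
    have := triv_cocycle_comp w_gr wd (ca _); rewrite !addr0 -!PoszD (addnC n) (addnC j).
    by apply=> v; rewrite ad scale1r.
  have [hS _] := triv_cocycle_lin (ksign K n%:Z) (triv_cocycle_sum cpsiw)
    (triv_cocycle0 _ _ _).
  apply: (triv_homE hphi' hS) => {}y gy.
  rewrite addr0 -(lamE (res_d P' y) (phi' y)); last by exists y.
  have gdy : res_gr (n%:Z, (j + 1)%N%:Z) (res_d P' y).
    by have := res_d_deg gy; rewrite PoszD addrK.
  have psi_w l : psi l (alpha (w l y)) = ksign K n%:Z * chi l (alpha (w l (res_d P' y))).
    have [w_gr wd _] := wE l; have [kc _] := chiE l.
    rewrite /psi hpart_id; last first.
      have := a_gr _ _ _ (w_gr _ _ _ gy); rewrite !subr0.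
      by rewrite !PoszD ![_ + 1%N%:Z]addrC !addrK.
    by rewrite ad wd linearZ /= ksign_alg (proj2 kc).
  under eq_bigr do rewrite psi_w.
  rewrite -mulr_sumr mulrA ksignK mul1r.
  (* [P'_n] is generated in the single degree [j], so an element of degree [j + 1] is a sum of
     products of [A_1] with elements of degree [j]. *)
  have [q [c [v [-> cv]]]] := Delta_decomp genP' gdy.
  rewrite (klinear_sum _ _ _ klam).
  under [RHS]eq_bigr => l _ do rewrite !linear_sum (klinear_sum _ _ _ (proj1 (chiE l))).
  rewrite exchange_big; apply: eq_bigr => i _.
  case: (cv i) => [->|[k' [j' [j'D gv gc ej]]]].
    rewrite scale0r (klinear0 klam) big1 // => l _.
    by rewrite !linear0 (klinear0 (proj1 (chiE l))).
  have jj' : j' = j by rewrite Delta0 in j'D; case: j'D.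
  by apply: lam_sum; [rewrite (_ : 1%N = k') //; lia | rewrite -jj'].
have cpsia l : triv_cocycle 1 1 (psi l \o alpha).
  have := triv_cocycle_comp (f := alpha) a_gr _ (cpsi l); rewrite !addr0; apply=> y.
  by rewrite ad scale1r.
have [z zE] := choice (fun l => lift_cocycle P (cpsia l)).
have chain_z l : chain_endo 1 1 (z l).
  have [z_gr zd _] := zE l; split; first by split; [exact: linearP | exact: z_gr].
  by move=> y; rewrite /dEnd zd subrr.
have chain_w l : chain_endo n%:Z j%:Z (w l \o alpha).
  have [w_gr wd _] := wE l; split; last by move=> y; rewrite /dEnd /= wd ad subrr.
  split; first exact: (linearP (w l \o alpha)).
  by move=> i i' y gy; have := w_gr _ _ _ (a_gr _ _ _ gy); rewrite !subr0.
exists r, (fun l => ext_class E (z l)), (fun l => ext_class E (w l \o alpha)).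
have ceta_a l : triv_cocycle n%:Z j%:Z (eta l \o alpha).
  have := triv_cocycle_comp (f := alpha) a_gr _ (ceta l); rewrite !addr0; apply=> y.
  by rewrite ad scale1r.
split.
  move=> l; rewrite /ext_class; split; apply: ext_cls_gr.
    have [_ _ ze] := zE l; have <- // : psi l \o alpha = (fun x => res_eps (z l x)).
    by apply/funext => y; rewrite ze.
  have [_ _ we] := wE l; have <- // : eta l \o alpha = (fun x => res_eps (w l (alpha x))).
  by apply/funext => y; rewrite we.
exists (ksign K n%:Z).
have zwE l : m [:: ext_class E (z l); ext_class E (w l \o alpha)] =
    ext_cls E (fun x => psi l (alpha (w l (alpha x)))).
  rewrite (mY _ _ _ _ _ _ (chain_z l) (chain_w l)); congr ext_cls.
  by apply/funext => y /=; have [_ _ ze] := zE l; rewrite ze.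
have czw l : @triv_cocycle K A P (1 + n%:Z) (1 + j%:Z)
    (fun x => psi l (alpha (w l (alpha x)))).
  have [[_ w_gr] wd] := chain_w l.
  have := triv_cocycle_comp (f := w l \o alpha) w_gr _ (cpsia l); apply=> y.
  by apply/eqP; rewrite -subr_eq0; apply/eqP/wd.
under eq_bigr do rewrite zwE.
rewrite -(ext_cls_sum _ czw) -[RHS]addr0 -(ext_cls0 E).
rewrite -(ext_cls_lin _ _ (triv_cocycle_sum czw) (triv_cocycle0 _ _ _)).
by congr ext_cls; apply/funext => y; rewrite /= phi'E.
Qed.
End ExtOfBiKoszul.

(** * Multilinear operations and the Stasheff identities *)

Lemma homs_map (I J V : Type) (g : I -> V -> Prop) (g' : J -> V -> Prop)
    (h : I -> J) ps xs :
  (forall i x, g i x -> g' (h i) x) -> homs g ps xs -> homs g' (map h ps) xs.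
Proof.
by move=> gg'; elim: ps xs => [|p ps IH] [|x xs] //= [/gg' gx /IH].
Qed.

Lemma homs_cat (I V : Type) (g : I -> V -> Prop) ps ps' xs xs' :
  homs g ps xs -> homs g ps' xs' -> homs g (ps ++ ps') (xs ++ xs').
Proof. by elim: ps xs => [|p ps IH] [|x xs] //= [gx /IH h] /h. Qed.

Lemma homs_size (I V : Type) (g : I -> V -> Prop) ps xs :
  homs g ps xs -> size ps = size xs.
Proof. by elim: ps xs => [|p ps IH] [|x xs] //= [_ /IH ->]. Qed.

Lemma homs_ex (I : Type) (V : eqType) (g : I -> V -> Prop) xs :
  all_in (fun x => exists i, g i x) xs -> exists ps, homs g ps xs.
Proof.
elim: xs => [|x xs IH] h; first by exists [::].
have [i gx] := h x (mem_head _ _); have [|ps gps] := IH.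
  by move=> y ys; apply: h; rewrite inE ys orbT.
by exists (i :: ps).
Qed.

Lemma all_in_cat (V : eqType) (H : V -> Prop) xs ys :
  all_in H (xs ++ ys) <-> all_in H xs /\ all_in H ys.
Proof.
split=> [h|[hx hy] x]; last by rewrite mem_cat => /orP[/hx|/hy].
by split=> x xs'; apply: h; rewrite mem_cat xs' ?orbT.
Qed.

Lemma all_in_cons (V : eqType) (H : V -> Prop) x xs :
  all_in H (x :: xs) <-> H x /\ all_in H xs.
Proof.
split=> [h|[hx hxs] y]; last by rewrite inE => /predU1P[->|/hxs].
by split=> [|y ys]; apply: h; rewrite inE ?eqxx // ys orbT.
Qed.

Lemma all_in_sub (V : eqType) (H H' : V -> Prop) xs :
  (forall x, H x -> H' x) -> all_in H xs -> all_in H' xs.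
Proof. by move=> HH' h x /h/HH'. Qed.

Lemma sum_triangle_single (V : nmodType) n (g : nat -> nat -> V) i0 t0 :
  (i0 < n)%N -> (1 <= t0 <= n - i0)%N ->
  (forall i t, (i < n)%N -> (1 <= t <= n - i)%N -> (i, t) <> (i0, t0) -> g i t = 0) ->
  \sum_(0 <= i < n) \sum_(1 <= t < (n - i).+1) g i t = g i0 t0.
Proof.
move=> i0n t0n g0; rewrite (bigD1_seq i0) ?mem_index_iota ?iota_uniq //=.
rewrite (bigD1_seq t0) ?mem_index_iota ?iota_uniq //= -addrA.
rewrite [X in _ + (X + _)]big1_seq ?[X in _ + (_ + X)]big1_seq ?addr0 //.
  move=> i /andP[/eqP ii0]; rewrite mem_index_iota => /= ilt.
  by rewrite big_nat big1 // => t; rewrite ltnS => tt; apply: g0 => // -[].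
move=> t /andP[/eqP tt0]; rewrite mem_index_iota ltnS => tt.
by apply: g0 => // -[].
Qed.

Section Multilinear.
Variables (K : fieldType) (V W : lmodType K) (H : V -> Prop).

Definition multilinear_on (f : seq V -> W) : Prop :=
  forall s1 s2 (a : K) x y, all_in H s1 -> all_in H s2 -> H x -> H y ->
    f (s1 ++ (a *: x + y) :: s2) = a *: f (s1 ++ x :: s2) + f (s1 ++ y :: s2).

Hypothesis H_sub : subgroup H.

Lemma subgroup_sum (U : zmodType) (T : U -> Prop) (J : eqType) (s : seq J) (F : J -> U) :
  subgroup T -> (forall j, j \in s -> T (F j)) -> T (\sum_(j <- s) F j).
Proof.
move=> [T0 TB] Ts; rewrite big_seq; elim/big_rec: _ => // j x /Ts Tj Tx.
have TN : T (- x) by rewrite -sub0r; exact: TB.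
by rewrite -[x]opprK; exact: TB.
Qed.

Lemma multilinear0 f s1 s2 : multilinear_on f ->
  all_in H s1 -> all_in H s2 -> f (s1 ++ 0 :: s2) = 0.
Proof.
move=> fL h1 h2; have H0 := H_sub.1; have := fL s1 s2 1 0 0 h1 h2 H0 H0.
rewrite scaler0 addr0 scale1r => /eqP.
by rewrite -subr_eq0 opprD addrA subrr sub0r oppr_eq0 => /eqP.
Qed.

Lemma multilinear_sum f s1 s2 (J : eqType) (s : seq J) (F : J -> V) : multilinear_on f ->
  all_in H s1 -> all_in H s2 -> (forall j, j \in s -> H (F j)) ->
  f (s1 ++ (\sum_(j <- s) F j) :: s2) = \sum_(j <- s) f (s1 ++ F j :: s2).
Proof.
move=> fL h1 h2; elim: s => [|j s IH] hF; first by rewrite !big_nil multilinear0.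
have hFs l : l \in s -> H (F l) by move=> ls; apply: hF; rewrite inE ls orbT.
rewrite !big_cons -[F j]scale1r fL ?IH ?scale1r //; first by apply/hF/mem_head.
exact: subgroup_sum.
Qed.

(** Entries are decomposed one at a time from the left; the statement is generalised over a prefix
    that already consists of elements of [S]. *)
Lemma multilinear_ind (S : V -> Prop) (T : W -> Prop) f n : multilinear_on f ->
  (forall x, S x -> H x) ->
  (forall x, H x -> exists2 ys, all_in S ys & x = \sum_(y <- ys) y) ->
  subgroup T -> (forall xs, size xs = n -> all_in S xs -> T (f xs)) ->
  forall xs, size xs = n -> all_in H xs -> T (f xs).
Proof.
move=> fL SH HS T_sub TS xs; rewrite -[xs]cat0s; set s1 := [::].
have hs1 : all_in S s1 by [].
elim: xs s1 hs1 => [|x xs IH] s1 hs1 sz; first by rewrite cats0 in sz *; auto.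
move=> /all_in_cat[_ /all_in_cons[hx hxs]].
have [ys hys ->] := HS x hx; have H1 := all_in_sub SH hs1.
rewrite multilinear_sum //; last by move=> y /hys/SH.
apply: subgroup_sum => // y yys; rewrite -cat_rcons; apply: IH.
- by rewrite -cats1; apply/all_in_cat; split=> // z; rewrite inE => /eqP ->; apply: hys.
- by move: sz; rewrite !size_cat size_rcons /=; lia.
- apply/all_in_cat; split=> //; rewrite -cats1; apply/all_in_cat; split=> // z.
  by rewrite inE => /eqP ->; apply/SH/hys.
Qed.

End Multilinear.

Section Restriction.
Variables (K : fieldType) (V : lmodType K) (gr : int -> V -> Prop) (u : V).
Variable m : seq V -> V.

Lemma Ainf_restrict (H H' : V -> Prop) : Ainf_algebra H gr u m ->
  (forall x, H' x -> H x) -> graded_space H' gr -> H' u ->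
  (forall xs, (0 < size xs)%N -> all_in H' xs -> H' (m xs)) ->
  Ainf_algebra H' gr u m.
Proof.
move=> [_ _ mL mdeg mst [_ u0] umul ustr] sHH gH' H'u H'm.
have sub xs : all_in H' xs -> all_in H xs by apply: all_in_sub.
split=> //.
- by move=> *; apply: mL; auto.
- by move=> *; apply: mdeg; auto.
- by move=> *; apply: mst; auto.
- by move=> x /sHH/umul.
- by move=> xs /sub; apply: ustr.
Qed.

Lemma size_stasheff_outer (xs : seq V) y i t : (i < size xs)%N ->
  (t <= size xs - i)%N ->
  size (take i xs ++ y :: drop (i + t) xs) = (size xs - t).+1.
Proof. by move=> ix tx; rewrite size_cat size_take ix /= size_drop; lia. Qed.

Lemma size_stasheff_inner (xs : seq V) i t : (i < size xs)%N ->
  (t <= size xs - i)%N -> size (take t (drop i xs)) = t.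
Proof. by move=> ix tx; rewrite size_take size_drop; case: ltnP; lia. Qed.

(* The two arities composed in a term of the Stasheff identity on [n] arguments
   have sum [n + 1].  If these sums separate the pairs from [ns] from all other
   pairs, each identity has either only terms from [ns] or none. *)
Lemma only_Ainf (H : V -> Prop) (ms ns : seq nat) : Ainf_algebra H gr u m ->
  (forall xs, (0 < size xs)%N -> all_in H xs -> size xs \notin ms -> m xs = 0) ->
  {subset ns <= ms} -> 2%N \in ns ->
  (forall s t s' t', s \in ms -> t \in ms -> s' \in ns -> t' \in ns ->
     (s + t = s' + t')%N -> s \in ns /\ t \in ns) ->
  Ainf_algebra H gr u (only ns m).
Proof.
move=> Am m_ms ns_ms ns2 sep; have [gH Hm mL mdeg mst [Hu u0] umul ustr] := Am.
have H_sub : subgroup H by case: gH => -[].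
have H_gr_sub i : subgroup (gr i) by case: gH => -[].
have H0 := H_sub.1.
have mL' : multilinear_on H m by [].
split=> //.
- by move=> xs xs0 hxs; rewrite /only; case: ifP => // _; apply: Hm.
- move=> s1 s2 a x y h1 h2 hx hy; rewrite /only !size_cat /=; case: ifP => _; first exact: mL.
  by rewrite scaler0 addr0.
- move=> ps xs xs0 hxs hps; rewrite /only; case: ifP => _; first exact: mdeg.
  by case: (H_gr_sub (\sum_(p <- ps) p + 2 - (size xs)%:Z)).
- move=> ps xs xs0 hxs hps.
  pose on t := (t \in ns) && ((size xs - t).+1 \in ns).
  pose on' t := (t \in ms) && ((size xs - t).+1 \in ms).
  have term (i t : nat) : (i < size xs)%N -> (1 <= t <= size xs - i)%N ->
      only ns m (take i xs ++ only ns m (take t (drop i xs)) :: drop (i + t) xs) =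
      if on t then m (take i xs ++ m (take t (drop i xs)) :: drop (i + t) xs) else 0.
    move=> ix /andP[t1 tx]; rewrite /only size_stasheff_outer // size_stasheff_inner // /on.
    case: (t \in ns); case: (_ \in ns) => //=.
    by apply: (multilinear0 H_sub mL'); [move=> z /mem_take/hxs | move=> z /mem_drop/hxs].
  have term' (i t : nat) : (i < size xs)%N -> (1 <= t <= size xs - i)%N -> ~~ on' t ->
      m (take i xs ++ m (take t (drop i xs)) :: drop (i + t) xs) = 0.
    move=> ix /andP[t1 tx]; rewrite negb_and => /orP[nt|nt].
      rewrite (m_ms (take t _)) ?size_stasheff_inner //.
        by apply: (multilinear0 H_sub mL'); [move=> z /mem_take/hxs | move=> z /mem_drop/hxs].
      by move=> z /mem_take/mem_drop/hxs.
    apply: m_ms; rewrite ?size_stasheff_outer //.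
    apply/all_in_cat; split; first by move=> z /mem_take/hxs.
    apply/all_in_cons; split; last by move=> z /mem_drop/hxs.
    apply: Hm; first by rewrite size_stasheff_inner.
    by move=> z /mem_take/mem_drop/hxs.
  have [[t0 t0x ton]|noton] := EM (exists2 t0, (1 <= t0 <= size xs)%N & on t0).
    rewrite -[RHS](mst ps xs) // /stasheff_sum.
    apply: eq_big_nat => i /andP[_ ix]; apply: eq_big_nat => t; rewrite ltnS => tx.
    rewrite (term i t) //; congr (_ *: _); case: ifP => // nt.
    have [/andP[ta tb]|not'] := boolP (on' t); last by rewrite term'.
    move/andP: ton => [na nb]; move/negP: nt; case; apply/andP.
    have [tn t0n] : (t <= size xs)%N /\ (t0 <= size xs)%N.
      by case/andP: tx t0x => _ tx /andP[_ ->]; rewrite (leq_trans tx (leq_subr _ _)).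
    by apply: (sep _ _ _ _ ta tb na nb); rewrite !addnS !subnKC.
  rewrite /stasheff_sum big_nat big1 // => i ix.
  rewrite big_nat big1 // => t; rewrite ltnS => tx; rewrite term //.
  case: ifP => [ton|_]; last by rewrite scaler0.
  by case: noton; exists t => //; move/andP: tx => [-> tx] /=;
    apply: leq_trans tx (leq_subr _ _).
- by move=> x hx; rewrite /only /= ns2; apply: umul.
- by move=> xs hxs uxs sz; rewrite /only; case: ifP => // _; apply: ustr.
Qed.

End Restriction.

(** * Sums of bigraded components as graded subspaces *)

Section GradedSubspaces.
Variables (K : fieldType) (V : lmodType K) (gr : int * int -> V -> Prop).
Hypothesis gV : graded_space (@whole V) gr.
Let iV : internal_grading (@whole V) gr. Proof. by case: gV. Qed.

Lemma hsum_scale S (a : K) x : hsum gr S x -> hsum gr S (a *: x).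
Proof.
case: gV => _ _ grZ [s [f [gf Ss ->]]]; exists s, (fun i => a *: f i).
by split=> // [i|]; [apply: grZ | rewrite scaler_sumr].
Qed.

Lemma hsum_hpart S i x : hsum gr S x -> hsum gr S (hpart iV i x).
Proof.
move=> /(hsumP iV) hx; have [->|/hx Si] := EM (hpart iV i x = 0).
  exact: hsum0.
by apply: (hsum_gr iV Si); apply: hpart_gr.
Qed.

Lemma hsum_subgroup S : subgroup (hsum gr S).
Proof. by split=> [|x y]; [apply: hsum0 | apply: (hsumB iV)]. Qed.

Lemma hsum_graded S : graded_space (hsum gr S) gr.
Proof.
have [[_ gr_sub _ gr_uniq] _ grZ] := gV; split=> //; last by move=> *; apply: hsum_scale.
split=> // [|x hx|s f us gf].
- exact: hsum_subgroup.
- have [s _ xE] := hpart_supp iV x; exists s, (hpart iV ^~ x); split=> // i.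
  by split; [apply: hsum_hpart | apply: hpart_gr].
- by apply: gr_uniq us _ => i; split=> //; case: (gf i).
Qed.

(** Components are grouped by their cohomological degree; directness is inherited from the whole
    space. *)
Lemma hsum_graded_coh S : graded_space (@whole V) (coh gr) ->
  graded_space (hsum gr S) (coh gr).
Proof.
move=> [[_ coh_sub _ coh_uniq] _ cohZ]; split=> //; last by move=> *; apply: hsum_scale.
split=> // [|x hx|s f us gf].
- exact: hsum_subgroup.
- have [s _ xE] := hpart_supp iV x.
  exists (undup (map fst s)), (fun p => \sum_(i <- s | i.1 == p) hpart iV i x).
  split=> [p|]; last first.
    rewrite {1}xE; apply: (sum_fibers _ (undup_uniq _)) => i.
    by rewrite mem_undup.
  rewrite -big_filter; split.
    apply: subgroup_sum => [|i _]; [exact: hsum_subgroup | exact: hsum_hpart].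
  apply: subgroup_sum => // i; rewrite mem_filter => /andP[/eqP ip _].
  by apply: (hsum_gr iV ip); apply: hpart_gr.
- by apply: coh_uniq us _ => i; split=> //; case: (gf i).
Qed.

Lemma coh_low_gr p j x : coh gr p x -> low gr j x -> gr (p, j) x.
Proof.
move=> /(hsumP iV) cx /(hsumP iV) lx; have [s _ ->] := hpart_supp iV x.
apply: (gr_sum iV) => i _; have [->|nz] := EM (hpart iV i x = 0); first exact: (gr0 iV).
by rewrite -(cx i nz) -(lx i nz) -surjective_pairing; apply: hpart_gr.
Qed.

Lemma gr_coh i x : gr i x -> coh gr i.1 x.
Proof. exact: hsum_gr. Qed.

Lemma gr_low i x : gr i x -> low gr i.2 x.
Proof. exact: hsum_gr. Qed.

End GradedSubspaces.

(** * Bidegrees of the pieces and admissible words *)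

Definition piece_row (q : piece) : nat :=
  match q with B0 => 0 | B1 => 1 | _ => 2 end.

Definition piece_shift (d : nat) (q : piece) : nat :=
  match q with B0 => 0 | B1 => 1 | B2d => d | B2d1 => d.+1 end.

(** A pair [z = (q, k)] names the [k]-th summand of the piece [q]. *)
Definition bidegree (d : nat) (z : piece * nat) : int * int :=
  ((3 * z.2 + piece_row z.1)%N%:Z, (2 * d * z.2 + piece_shift d z.1)%N%:Z).

Definition piece_support (d : nat) (q : piece) (pj : int * int) : Prop :=
  match q with
  | B0 => exists k : nat, pj.1 = (3 * k + 0)%N%:Z
  | B1 => exists k : nat, pj.1 = (3 * k + 1)%N%:Z
  | B2d => exists k : nat, pj = ((3 * k + 2)%N%:Z, (2 * d * k + d)%N%:Z)
  | B2d1 => exists k : nat, pj = ((3 * k + 2)%N%:Z, (2 * d * k + d.+1)%N%:Z)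
  end.

Lemma bidegree_support d z : piece_support d z.1 (bidegree d z).
Proof. by case: z => -[] k; exists k. Qed.

(** The pieces [B0] and [B1] fix only the cohomological degree; the lower grading comes from
    [Delta_support]. *)
Lemma piece_support_bidegree d q pj :
  piece_support d q pj -> Delta_support d pj -> exists k, pj = bidegree d (q, k).
Proof.
case: pj => p j; case: q => [[k /= ->]|[k /= ->]|[k ->]|[k ->]];
  rewrite /bidegree /=; try by exists k.
  move=> [n /= nk]; have -> : n = (3 * k)%N by lia.
  by rewrite Delta0 /= => -[] ->; exists k; rewrite !addn0.
move=> [n /= nk]; have -> : n = (3 * k + 1)%N by lia.
by rewrite Delta1 /= => -[] ->; exists k.
Qed.

Lemma trunc_rule_B1B1 d r : (4 <= d)%N -> ~ trunc_rule d [:: B1; B1] r.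
Proof.
move=> hd; case=> [pw|pw|pw|pw|pw|pw|wE|pw|wE]; try by [].
- by have := perm_size pw; rewrite /= size_nseq; lia.
- by have := congr1 size wE; rewrite size_nseq /=; lia.
- by have := perm_size pw; rewrite /= size_nseq; lia.
- by have := congr1 size wE; rewrite size_nseq /=; lia.
Qed.

Section TruncRules.
Variables (d : nat) (q2 : piece).
Hypotheses (hd : (4 <= d)%N) (hq2 : q2 = B2d \/ q2 = B2d1).
(** The shift of [q2] is also the arity: [d] for [B2d], [d.+1] for [B2d1]. One parameter thus covers
    both F and G. *)
Let t := piece_shift d q2.
Let qs := [:: B0; B1; q2].

(** A value in E^{[2]} leaves open which half it lies in; the two shapes of words listed are those
    for which a degree count has to decide. *)
Lemma trunc_rule_cases w r : trunc_rule d w r -> all (mem qs) w ->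
    size w \in [:: 2%N; t] ->
  [\/ r = 0%N, r = 1%N | r = 2%N /\ (perm_eq w [:: B0; q2] \/ w = nseq t B1)].
Proof.
have B2d_w : B2d \in w -> all (mem qs) w -> q2 = B2d.
  by move=> Bw /allP /(_ _ Bw); rewrite !inE /=; case: hq2 => ->.
have B2d1_w : B2d1 \in w -> all (mem qs) w -> q2 = B2d1.
  by move=> Bw /allP /(_ _ Bw); rewrite !inE /=; case: hq2 => ->.
case=> [pw|pw|pw|pw|pw|pw|wE|pw|wE] wqs sz; try by [constructor 1 | constructor 2].
- by constructor 3; split=> //; left; rewrite B2d_w // (perm_mem pw) !inE eqxx orbT.
- by constructor 3; split=> //; left; rewrite B2d1_w // (perm_mem pw) !inE eqxx orbT.
- constructor 3; split=> //; right; rewrite wE; move: sz; rewrite wE size_nseq /t.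
  by case: hq2 => -> //=; rewrite !inE; case/orP => /eqP; lia.
- constructor 3; split=> //; right; rewrite wE; move: sz; rewrite wE size_nseq /t.
  by case: hq2 => -> //=; rewrite !inE; case/orP => /eqP; lia.
Qed.

(** The mixed rules couple arity [d] with [B2d1] and arity [d.+1] with [B2d], each time the half
    that is left out here. *)
Lemma trunc_rule_full w r : trunc_rule d w r -> all (mem qs) w -> size w = t ->
  w = nseq t B1.
Proof.
have t4 : (4 <= t)%N by rewrite /t; case: hq2 => -> /=; lia.
have B2d_w : B2d \in w -> all (mem qs) w -> q2 = B2d.
  by move=> Bw /allP /(_ _ Bw); rewrite !inE /=; case: hq2 => ->.
have B2d1_w : B2d1 \in w -> all (mem qs) w -> q2 = B2d1.
  by move=> Bw /allP /(_ _ Bw); rewrite !inE /=; case: hq2 => ->.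
case=> [pw|pw|pw|pw|pw|pw|wE|pw|wE] wqs sz;
  try by have := perm_size pw; rewrite sz /=; lia.
- have q2E : q2 = B2d1 by apply: B2d1_w => //; rewrite (perm_mem pw) mem_head.
  by have := perm_size pw; rewrite sz /t q2E /= size_nseq; lia.
- by rewrite -sz wE size_nseq.
- have q2E : q2 = B2d by apply: B2d_w => //; rewrite (perm_mem pw) mem_head.
  by have := perm_size pw; rewrite sz /t q2E /= size_nseq; lia.
- by rewrite -sz wE size_nseq.
Qed.

End TruncRules.

(** * The pieces of a truncated bi-Koszul algebra *)

Section Pieces.
Variables (K : fieldType) (A : gradedAlgebra K) (d : nat).
Hypotheses (hd : (4 <= d)%N) (hA : bi_Koszul A d).
Variables (P : freeResolution A) (E : extSpace P) (m : seq E -> E).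
Hypotheses (hm : Ainf_Ext_structure m) (htr : truncated d m).
Variable q2 : piece.
Hypothesis hq2 : q2 = B2d \/ q2 = B2d1.

Let gr := @ext_gr K A P E.
Let t := piece_shift d q2.
Let qs := [:: B0; B1; q2].
Let H := @piece_sum K A P E d qs.
Let M := only [:: 2%N; t] m.
Let gE : graded_space (@whole E) gr := ext_graded E.
Let iE : internal_grading (@whole E) gr.
Proof. by case: gE. Qed.

Lemma t_ge4 : (4 <= t)%N.
Proof. by rewrite /t; case: hq2 => -> /=; lia. Qed.

Lemma in_pieceE q x : @in_piece K A P E d q x <-> hsum gr (piece_support d q) x.
Proof. by case: q. Qed.

Lemma pieces_hsum x :
  H x <-> hsum gr (fun pj => exists2 q, q \in qs & piece_support d q pj) x.
Proof.
split=> [[g [gp ->]]|[s [f [gf Ss ->]]]].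
  rewrite big_seq; elim/big_rec: _ => [|q y qqs hy]; first exact: hsum0.
  apply: (hsumD iE) => //; apply/(hsumP iE) => i nz; exists q => //.
  by have /in_pieceE/(hsumP iE) := gp q; apply.
have [|c cE] := @choice (int * int) piece
    (fun i q => i \in s -> q \in qs /\ piece_support d q i).
  move=> i; have [/Ss[q qqs qi]|nis] := boolP (i \in s); last by exists B0.
  by exists q.
exists (fun q => \sum_(i <- s | c i == q) f i); split=> [q|]; last first.
  apply: sum_fibers; first by rewrite /qs /=; case: hq2 => ->.
  by move=> q /mapP[i /cE[cq _] ->].
apply/in_pieceE; rewrite -big_filter; apply: subgroup_sum.
  exact: (hsum_subgroup gE).
move=> i; rewrite mem_filter => /andP[/eqP <- /cE[_ ci]].
exact: (hsum_gr iE ci).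
Qed.

Lemma H_eq : H = hsum gr (fun pj => exists2 q, q \in qs & piece_support d q pj).
Proof. by apply/funext => x; apply/propext/pieces_hsum. Qed.

Lemma H_graded : graded_space H gr.
Proof. by rewrite H_eq; apply: hsum_graded. Qed.

Lemma H_graded_coh : graded_space H (coh gr).
Proof. by rewrite H_eq; apply: (hsum_graded_coh gE); case: (AE_algebra hm). Qed.

Lemma H_subgroup : subgroup H.
Proof. by case: H_graded => -[]. Qed.

Definition homogeneous (x : E) : Prop :=
  exists2 z, z.1 \in qs & gr (bidegree d z) x.

Lemma gr_in_piece z x : gr (bidegree d z) x -> @in_piece K A P E d z.1 x.
Proof. by move=> gx; apply/in_pieceE/(hsum_gr iE _ gx)/bidegree_support. Qed.

Lemma piece_H q x : q \in qs -> @in_piece K A P E d q x -> H x.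
Proof.
move=> qqs /in_pieceE/(hsumP iE) hx; apply/pieces_hsum/(hsumP iE) => i /hx.
by exists q.
Qed.

Lemma homogeneous_H x : homogeneous x -> H x.
Proof. by case=> z zqs /gr_in_piece; apply: piece_H. Qed.

Lemma H_homogeneous x : H x -> exists2 ys, all_in homogeneous ys & x = \sum_(y <- ys) y.
Proof.
move=> /pieces_hsum/(hsumP iE) hx; have [s _ xE] := hpart_supp iE x.
exists [seq hpart iE i x | i <- s]; last by rewrite big_map.
move=> _ /mapP[i _ ->]; have gi := hpart_gr iE i x.
have [->|nz] := EM (hpart iE i x = 0).
  (* A zero component may be given any bidegree. *)
  by exists (B0, 0%N) => //; apply: (gr0 iE).
have [q qqs /piece_support_bidegree] := hx i nz.
case: i gi nz => p j gi nz /(_ (ext_support hA gi nz))[k ij].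
by exists (q, k) => //; rewrite -ij.
Qed.

Lemma coh_gr p j x : coh gr p x ->
  (forall i, Delta_support d i -> i.1 = p -> i = (p, j)) -> gr (p, j) x.
Proof.
move=> /(hsumP iE) cx one; have [s _ ->] := hpart_supp iE x.
apply: (gr_sum iE) => i _; have [->|nz] := EM (hpart iE i x = 0); first exact: (gr0 iE).
have gi := hpart_gr iE i x; rewrite -(one i) //; last exact: cx.
by case: i gi nz => p' j' gi nz; apply: ext_support hA gi nz.
Qed.

(** Both entries of [Delta d (3 * k + 1)] agree, so the cohomological degree alone fixes the lower
    grading. *)
Lemma coh_row1 k x : coh gr (3 * k + 1)%N%:Z x -> gr (bidegree d (B1, k)) x.
Proof.
move=> cx; apply: coh_gr cx _ => -[p j] [n /= nE jE] pE.
have nk : n = (3 * k + 1)%N by lia.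
by move: jE; rewrite nk Delta1 /= pE; case=> ->.
Qed.

Lemma unit_H : H (ext_unit E).
Proof.
have [_ u0] := Ai_unit_in (AE_algebra hm).
apply: (piece_H (q := B0)) => //; apply/in_pieceE/(hsumP iE) => i nz.
by exists 0%N; move/(hsumP iE): u0; apply.
Qed.

Lemma homogeneous_word xs : all_in homogeneous xs -> exists zs : seq (piece * nat),
  all (mem qs) (map fst zs) /\ homs (fun z => gr (bidegree d z)) zs xs.
Proof.
elim: xs => [|x xs IH] h; first by exists [::].
have [[z zqs gz] /IH[zs [zsqs gzs]]] := (all_in_cons _ _ _).1 h.
by exists (z :: zs); rewrite /= zqs.
Qed.

Lemma homs_piece zs xs : homs (fun z => gr (bidegree d z)) zs xs ->
  homs (@in_piece K A P E d) (map fst zs) xs.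
Proof. by apply: homs_map; apply: gr_in_piece. Qed.

Lemma sum_bidegree zs : exists k : nat,
  \sum_(z <- zs) (bidegree d z).1 =
    (3 * k + \sum_(q <- map fst zs) piece_row q)%N%:Z /\
  \sum_(z <- zs) (bidegree d z).2 =
    (2 * d * k + \sum_(q <- map fst zs) piece_shift d q)%N%:Z.
Proof.
elim: zs => [|[q l] zs [k [IH1 IH2]]]; first by exists 0%N; rewrite !big_nil !muln0.
exists (l + k)%N; rewrite !big_cons IH1 IH2 /= -!PoszD.
by split; congr Posz; rewrite mulnDr addnACA.
Qed.

Lemma mult_bidegree zs xs : (0 < size xs)%N ->
  homs (fun z => gr (bidegree d z)) zs xs -> exists k : nat,
  gr ((3 * k + \sum_(q <- map fst zs) piece_row q)%N%:Z + 2 - (size xs)%:Z,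
      (2 * d * k + \sum_(q <- map fst zs) piece_shift d q)%N%:Z) (m xs).
Proof.
move=> xs0 gxs; have [k [e1 e2]] := sum_bidegree zs; exists k.
apply: (coh_low_gr gE); rewrite -?e1 -?e2.
  rewrite -(big_map (fun z => (bidegree d z).1) xpredT id).
  apply: (Ai_degree (AE_algebra hm)) => //.
  by apply: homs_map gxs => z x; apply: (gr_coh gE).
rewrite -(big_map (fun z => (bidegree d z).2) xpredT id).
apply: (AE_low hm) => //.
by apply: homs_map gxs => z x; apply: (gr_low gE).
Qed.

Lemma m_multilinear : multilinear_on (@whole E) m.
Proof. exact: (Ai_multilinear (AE_algebra hm)). Qed.

Lemma M_Ainf : Ainf_algebra (@whole E) (coh gr) (ext_unit E) M.
Proof.
have t4 := t_ge4; have [mult0 _ _] := htr.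
apply: (only_Ainf (AE_algebra hm) (ms := [:: 2%N; d; d.+1])).
- by move=> xs xs0 _; apply: mult0.
- by rewrite /t; case: hq2 => -> /= s; rewrite !inE => /orP[] /eqP ->; rewrite eqxx ?orbT.
- by rewrite mem_head.
(* The sums are 4, d+2, d+3, 2d, 2d+1 and 2d+2; for d at least 3 the only collision is 2 + (d+1) = d
   + d, at d = 3. *)
- move=> s s' r r'; rewrite /t !inE.
  case: hq2 => -> /=; move=> /or3P[] /eqP -> /or3P[] /eqP ->
    /orP[] /eqP -> /orP[] /eqP -> e;
   rewrite ?eqxx ?orbT //; exfalso; lia.
Qed.

Lemma H_closed xs : (0 < size xs)%N -> all_in H xs -> H (M xs).
Proof.
move=> xs0 hxs; rewrite /M /only; case: ifP => // sz; last exact: H_subgroup.1.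
apply: (multilinear_ind H_subgroup (f := m) (n := size xs) _ homogeneous_H
  H_homogeneous H_subgroup) hxs => //.
  by move=> s1 s2 a x y *; apply: m_multilinear.
move=> ys ysz hys; have [zs [zsqs gzs]] := homogeneous_word hys.
have szz := homs_size gzs; have [_ truncV mult0] := htr.
have ys0 : (0 < size ys)%N by rewrite ysz.
have [[r hr]|nr] := EM (exists r, trunc_rule d (map fst zs) r); last first.
  rewrite (mult0 (map fst zs)) ?size_map ?szz //; first exact: H_subgroup.1.
    by move=> r hr; apply: nr; exists r.
  exact: homs_piece.
have := truncV _ _ _ hr (homs_piece gzs).
have := trunc_rule_cases hd hq2 hr zsqs; rewrite size_map szz ysz => /(_ sz).
case=> [->|->|[-> hw] _]; first exact: (@piece_H B0).
  exact: (@piece_H B1).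
(* The lower grading selects the half of E^{[2]}: [t] factors from E^{[1]} add up to the shift [t],
   which is that of [q2]. *)
have [k gm] := mult_bidegree ys0 gzs; apply: (@piece_H q2).
  by rewrite !inE eqxx !orbT.
apply: (@gr_in_piece (q2, k)); congr (gr _ _): gm; rewrite /bidegree /=.
case: hw => [pw|wE].
  rewrite !(perm_big _ pw) /= !big_cons !big_nil -szz -(size_map fst) (perm_size pw) /=.
  by rewrite !addn0 !add0n addrK.
rewrite wE !big_nseq -szz -(size_map fst) wE size_nseq !iter_addn_0 /= !mul1n.
by case: hq2 => -> /=; congr (_, _); lia.
Qed.

Lemma H_Ainf : Ainf_algebra H (coh gr) (ext_unit E) M.
Proof.
exact: Ainf_restrict M_Ainf (fun _ _ => Logic.I) H_graded_coh unit_H H_closed.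
Qed.

Lemma H_component i x : H x -> hpart iE i x <> 0 ->
  exists2 z, z.1 \in qs & i = bidegree d z.
Proof.
move=> /pieces_hsum/(hsumP iE) hx nz.
have [q qqs /piece_support_bidegree] := hx i nz.
have := hpart_gr iE i x; case: i nz => p j nz gi.
by case/(_ (ext_support hA gi nz)) => k ij; exists (q, k).
Qed.

(** Only one half of E^{[2]} is kept, so the residue modulo 3 of the cohomological degree determines
    the piece. Purity rests on this. *)
Lemma bidegree_inj z z' : z.1 \in qs -> z'.1 \in qs ->
  (bidegree d z).1 = (bidegree d z').1 -> bidegree d z = bidegree d z'.
Proof.
case: z z' => [q k] [q' k']; rewrite /bidegree /= !inE /=.
by case: hq2 => ->; move=> /or3P[] /eqP -> /or3P[] /eqP -> /= e; try lia;
  have -> : k = k' by lia.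
Qed.

Lemma H_minimal : minimal_mults H M.
Proof.
move=> x _; rewrite /M /only /= !inE /=.
by have := t_ge4; case: eqP => // <-.
Qed.

Lemma H_pure : pure gr H M.
Proof.
split; [exact: H_graded | exact: H_minimal | |].
  move=> js xs xs0 _ hjs; rewrite /M /only; case: ifP => _; last exact: hsum0.
  exact: (AE_low hm).
move=> p.
have [[z zqs pE]|np] := EM (exists2 z, z.1 \in qs & p = (bidegree d z).1); last first.
  (* Only 0 lives in such a degree [p], so any lower grading will do. *)
  exists 0 => x hx /(hsumP iE) cx; apply/(hsumP iE) => i nz.
  have [z zqs iz] := H_component hx nz.
  by case: np; exists z; rewrite // -iz (cx i nz).
exists (bidegree d z).2 => x hx /(hsumP iE) cx; apply/(hsumP iE) => i nz.
have [z' zqs' iz] := H_component hx nz; rewrite iz.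
by rewrite (bidegree_inj zqs' zqs) // -iz (cx i nz).
Qed.

Lemma H_single : single t H M.
Proof.
split; [exact: ltnW t_ge4 | exact: H_minimal |].
by move=> xs _ _ nsz; rewrite /M /only (negPf nsz).
Qed.

Lemma H_subalgebra : Ainf_subalgebra H (@whole E) (coh gr) (ext_unit E) M.
Proof.
by split; [exact: M_Ainf | | exact: H_graded_coh | exact: H_closed].
Qed.

(** * Uniqueness of the higher multiplication *)

Definition row1 (x : E) : Prop := exists k, gr (bidegree d (B1, k)) x.

Lemma row1_piece x : row1 x -> @in_piece K A P E d B1 x.
Proof. by case=> k; apply: (@gr_in_piece (B1, k)). Qed.

Lemma row1_H x : row1 x -> H x.
Proof. by move=> /row1_piece; apply: piece_H. Qed.

Lemma row1_mul k z x : gr (bidegree d (B0, k)) z -> row1 x -> row1 (m [:: z; x]).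
Proof.
move=> gz [l gx]; exists (k + l)%N; apply: coh_row1.
have := Ai_degree (AE_algebra hm) (xs := [:: z; x])
  (ps := [:: (bidegree d (B0, k)).1; (bidegree d (B1, l)).1]).
rewrite !big_cons big_nil /= addr0 addrK => /(_ isT) h.
rewrite (_ : (3 * (k + l) + 1)%N%:Z = (3 * k + 0)%N%:Z + (3 * l + 1)%N%:Z); last by lia.
by apply: h => //; split; [exact: (gr_coh gE gz) | split=> //; exact: (gr_coh gE gx)].
Qed.

Lemma row1_mulr k y z : gr (1, 1) y -> gr (bidegree d (B0, k)) z -> row1 (m [:: y; z]).
Proof.
move=> gy gz; exists k; apply: coh_row1.
have := Ai_degree (AE_algebra hm) (xs := [:: y; z])
  (ps := [:: 1; (bidegree d (B0, k)).1]).
rewrite !big_cons big_nil /= addr0 addrK => /(_ isT) h.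
rewrite (_ : (3 * k + 1)%N%:Z = 1 + (3 * k + 0)%N%:Z); last by lia.
by apply: h => //; split; [exact: (gr_coh gE gy) | split=> //; exact: (gr_coh gE gz)].
Qed.

Lemma row1_gr11 y : gr (1, 1) y -> row1 y.
Proof. by exists 0%N; rewrite /bidegree /= !muln0. Qed.

Lemma row1_decomp x : row1 x -> exists ys : seq (E * E), exists s : K,
  (forall yz, yz \in ys -> gr (1, 1) yz.1 /\ exists k, gr (bidegree d (B0, k)) yz.2) /\
  x = s *: \sum_(yz <- ys) m [:: yz.1; yz.2].
Proof.
move=> [k gx]; have d2 : (2 <= d)%N by lia.
have [r [y [z [yz [s ->]]]]] := ext_generation d2 hA (AE_Yoneda hm) gx.
exists [seq (y l, z l) | l <- index_enum 'I_r], s; split; last by rewrite big_map.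
move=> _ /mapP[l _ ->] /=; have [gy gz] := yz l; split=> //.
by exists k; rewrite /bidegree /= !addn0.
Qed.

Section Determined.
Variable m' : seq E -> E.
Let N := with_mult t m m'.
Hypothesis N_Ainf : Ainf_algebra H (coh gr) (ext_unit E) N.
Hypothesis m'_word0 : forall w xs, size w = t -> all (mem qs) w -> w <> nseq t B1 ->
  homs (@in_piece K A P E d) w xs -> m' xs = 0.
Hypothesis m'_base : forall xs, size xs = t -> all_in (coh gr 1) xs -> m' xs = m xs.

Lemma N_multilinear : multilinear_on H N.
Proof. exact: (Ai_multilinear N_Ainf). Qed.

Lemma M_multilinear : multilinear_on H M.
Proof. exact: (Ai_multilinear H_Ainf). Qed.

Lemma N_size2 x y : N [:: x; y] = m [:: x; y]. Proof. by []. Qed.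

Lemma M_size2 x y : M [:: x; y] = m [:: x; y].
Proof. by rewrite /M /only mem_head. Qed.

Lemma N_sizet xs : size xs = t -> N xs = m' xs.
Proof. by have := t_ge4; rewrite /N /with_mult => + ->; rewrite eqxx; case: eqP => // ->. Qed.

Lemma M_sizet xs : size xs = t -> M xs = m xs.
Proof. by rewrite /M /only => ->; rewrite !inE eqxx orbT. Qed.

Lemma NM_other xs : size xs != 2%N -> size xs != t -> N xs = 0 /\ M xs = 0.
Proof.
by rewrite /N /M /with_mult /only !inE => /negPf-> /negPf->.
Qed.

Lemma NM_word0 w xs : size w = t -> all (mem qs) w -> w <> nseq t B1 ->
  homs (@in_piece K A P E d) w xs -> N xs = 0 /\ M xs = 0.
Proof.
move=> wt wqs wn hxs; have xst : size xs = t by rewrite -(homs_size hxs).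
rewrite N_sizet // M_sizet // (m'_word0 wt wqs wn hxs); split=> //.
have w0 : (0 < size w)%N by rewrite wt; have := t_ge4; lia.
have [_ _ mult0] := htr; apply: mult0 w0 _ hxs => r hr.
by apply: wn; apply: trunc_rule_full hr wqs wt.
Qed.

Lemma row1_word xs : all_in row1 xs ->
  homs (@in_piece K A P E d) (nseq (size xs) B1) xs.
Proof.
elim: xs => [|x xs IH] //= /all_in_cons[/row1_piece gx /IH hxs]; by split.
Qed.

Lemma NM_row0 l1 l2 z : all_in row1 l1 -> all_in row1 l2 ->
  @in_piece K A P E d B0 z -> (size l1 + size l2).+1 = t ->
  N (l1 ++ z :: l2) = 0 /\ M (l1 ++ z :: l2) = 0.
Proof.
move=> h1 h2 hz sz.
apply: (@NM_word0 (nseq (size l1) B1 ++ B0 :: nseq (size l2) B1)).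
- by rewrite size_cat /= !size_nseq addnS.
- by rewrite all_cat /= !all_nseq /= !inE /= !orbT.
- move=> /(congr1 (mem^~ B0 \o id)) /=.
  by have -> : (B0 \in nseq t B1) = false; rewrite ?mem_cat ?mem_nseq ?inE ?eqxx ?orbT ?andbF.
- by apply: homs_cat; [exact: row1_word | split=> //; exact: row1_word].
Qed.

Lemma row1_mul0 x y : row1 x -> row1 y -> m [:: x; y] = 0.
Proof.
move=> hx hy; have [_ _ mult0] := htr.
apply: (mult0 [:: B1; B1]) => //; first by move=> r; apply: trunc_rule_B1B1.
by apply: (row1_word (xs := [:: x; y])) => z; rewrite !inE => /orP[] /eqP ->.
Qed.

Lemma NM_base s1 : size s1 = t -> all_in (gr (1, 1)) s1 -> N s1 = M s1.
Proof.
move=> sz h1; rewrite N_sizet // M_sizet // m'_base //.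
by apply: all_in_sub h1 => y; apply: (gr_coh gE).
Qed.

(* The Stasheff identity on [s1, y, z, s2]: every other term that does not vanish
   in both structures applies the big operation to [s1, y, m(z, x), ...] or, when
   [s2] is empty, to [s1, y]. *)
Lemma NM_step s1 s2 y z k :
  (forall x s, (size s).+1 = size s2 -> row1 x -> all_in row1 s ->
     N (rcons s1 y ++ x :: s) = M (rcons s1 y ++ x :: s)) ->
  (size s1 + size s2).+1 = t -> all_in (gr (1, 1)) s1 -> all_in row1 s2 ->
  gr (1, 1) y -> gr (bidegree d (B0, k)) z ->
  N (s1 ++ m [:: y; z] :: s2) = M (s1 ++ m [:: y; z] :: s2).
Proof.
move=> IH sz h1 h2 gy gz; have t4 := t_ge4.
pose xs := s1 ++ y :: z :: s2.
have szxs : size xs = t.+1 by rewrite size_cat /= !addnS sz.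
have hz := gr_in_piece gz; rewrite /= in hz.
have r1 : all_in row1 s1 by apply: all_in_sub h1; apply: row1_gr11.
have ry := row1_gr11 gy.
have r1y : all_in row1 (rcons s1 y).
  by rewrite -cats1; apply/all_in_cat; split=> // v; rewrite inE => /eqP ->.
have hxs : all_in H xs.
  apply/all_in_cat; split; first by apply: all_in_sub r1; apply: row1_H.
  apply/all_in_cons; split; first exact: row1_H.
  apply/all_in_cons; split; first exact: (@piece_H B0).
  by apply: all_in_sub h2; apply: row1_H.
have [ps hps] : exists ps, homs (coh gr) ps xs.
  apply: homs_ex; have r1_coh x : row1 x -> exists p, coh gr p x.
    by case=> l gx; exists (bidegree d (B1, l)).1; apply: (gr_coh gE).
  apply/all_in_cat; split; first by apply: all_in_sub r1.
  apply/all_in_cons; split; first exact: r1_coh.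
  apply/all_in_cons; split; last by apply: all_in_sub h2.
  by exists (bidegree d (B0, k)).1; apply: (gr_coh gE).
pose term (f : seq E -> E) i l := f (take i xs ++ f (take l (drop i xs)) :: drop (i + l) xs).
have inner0 i l : N (take l (drop i xs)) = 0 /\ M (take l (drop i xs)) = 0 ->
    term N i l = term M i l.
  rewrite /term => -[-> ->].
  have hpre : all_in H (take i xs) by move=> v /mem_take/hxs.
  have hpost : all_in H (drop (i + l) xs) by move=> v /mem_drop/hxs.
  by rewrite !(multilinear0 H_subgroup) //; [exact: M_multilinear | exact: N_multilinear].
have row1_nth j : (j < t.+1)%N -> j <> (size s1).+1 -> row1 (nth 0 xs j).
  move=> jt ja; rewrite /xs nth_cat; case: ltnP => js; first exact/r1/mem_nth.
  case e : (j - size s1)%N => [|[|j']] //=; first by lia.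
  by apply/h2/mem_nth; lia.
have eq_term i l : (i < size xs)%N -> (1 <= l <= size xs - i)%N ->
    (i, l) <> (size s1, 2%N) -> term N i l = term M i l.
  move=> ix lx il; rewrite szxs in ix lx.
  have szmid : size (take l (drop i xs)) = l.
    by rewrite size_stasheff_inner ?szxs //; case/andP: lx.
  have [l2|l2] := eqVneq l 2%N.
    have mid2 : take l (drop i xs) = [:: nth 0 xs i; nth 0 xs i.+1].
      rewrite l2 (drop_nth 0) ?szxs // (drop_nth 0) ?szxs; last by lia.
      by rewrite /= take0.
    (* Apart from the excluded pair [y, z], the only adjacent pair not inside E^{[1]} is [z] with
       the head of [s2], at this position. *)
    have [ia|ia] := eqVneq i (size s1).+1; last first.
      apply: inner0; rewrite mid2 N_size2 M_size2 row1_mul0 //; apply: row1_nth.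
      - by [].
      - exact/eqP.
      - by lia.
      - by move=> [] ei; apply: il; rewrite ei l2.
    case e2 : s2 => [|x s2']; first by move: sz lx; rewrite e2 l2 ia /=; lia.
    have xsE : xs = rcons s1 y ++ z :: x :: s2' by rewrite cat_rcons -e2.
    move: (h2); rewrite e2 => /all_in_cons[rx hs2].
    have szr : i = size (rcons s1 y) by rewrite size_rcons.
    rewrite /term xsE l2 addnC -drop_drop szr take_size_cat // drop_size_cat //=.
    rewrite take0 drop0 N_size2 M_size2.
    by apply: IH => //; [rewrite e2 | apply: row1_mul gz rx].
  have [lt|lt] := eqVneq l t; last by apply/inner0/NM_other; rewrite szmid.
  (* A window of [t] among [t + 1] entries starts at 0 or 1. *)
  have i01 : (i <= 1)%N by move: lx; rewrite lt; lia.
  case: i ix lx il szmid i01 => [|[|//]] ix lx il szmid _.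
    (* The window at 0 misses [z] only if [z] is the last entry; its entries then all lie in
       bidegree (1, 1), where the two operations agree. *)
    have [s2_nil|s2_ne] := eqVneq s2 [::].
      have xsE : xs = rcons s1 y ++ [:: z] by rewrite cat_rcons /xs s2_nil.
      have szr : l = size (rcons s1 y).
        by rewrite lt -sz s2_nil size_rcons addn0.
      rewrite /term add0n take0 drop0 /= xsE szr take_size_cat // drop_size_cat //.
      rewrite N_size2 M_size2 NM_base //; first by rewrite -szr.
      by rewrite -cats1; apply/all_in_cat; split=> // v; rewrite inE => /eqP ->.
    have [s2' [x e2]] : exists s2' x, s2 = rcons s2' x.
      by case/lastP: {+}s2 s2_ne => // s' x; exists s', x.
    have szmid' : l = size (rcons s1 y ++ z :: s2').
      by rewrite lt -sz e2 size_cat /= !size_rcons !addnS addSn.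
    have xsE : xs = (rcons s1 y ++ z :: s2') ++ [:: x].
      by rewrite -catA /= cats1 cat_rcons /xs e2.
    apply: inner0; rewrite drop0 xsE szmid' take_size_cat //.
    apply: NM_row0 => //; last by rewrite -lt szmid' size_cat /= addnS.
    by move=> v vs; apply: h2; rewrite e2 mem_rcons inE vs orbT.
  (* The window at 1 drops only the first entry, which is never [z], so both operations vanish on
     it. *)
  apply: inner0; rewrite take_oversize; last by rewrite size_drop szxs; lia.
  rewrite /xs; case e1 : s1 => [|c s1'] /=.
    by apply: (@NM_row0 [::]) => //; rewrite -sz e1.
  rewrite drop0 -cat_rcons; apply: NM_row0 => //.
    rewrite -cats1; apply/all_in_cat; split=> [v vs|v].
      by apply: r1; rewrite e1 inE vs orbT.
    by rewrite inE => /eqP ->.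
  by rewrite size_rcons -sz e1 /=; lia.
have main : term N (size s1) 2 = term M (size s1) 2.
  pose sg i l := ksign K ((i + (size xs - i - l) * l)%N%:Z +
             (2 - l%:Z) * \sum_(p <- take i ps) p).
  have xs0 : (0 < size xs)%N by rewrite szxs.
  (* In the difference of the two identities only the term multiplying [y] with [z] is left, up to
     an invertible sign. *)
  have := Ai_stasheff N_Ainf xs0 hxs hps.
  rewrite -(Ai_stasheff H_Ainf xs0 hxs hps) /stasheff_sum => /eqP.
  rewrite -subr_eq0 -sumrB; under eq_bigr do rewrite -sumrB.
  rewrite (sum_triangle_single (i0 := size s1) (t0 := 2)).
  - rewrite -scalerBr => /eqP/(congr1 ( *:%R (sg (size s1) 2%N))).
    by rewrite scalerA ksignK scale1r scaler0 => /eqP; rewrite subr_eq0 => /eqP.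
  - by rewrite szxs; lia.
  - by rewrite szxs; lia.
  - by move=> i l ix lx il; rewrite -/(term N i l) -/(term M i l) eq_term // subrr.
move: main; rewrite /term addnC -drop_drop take_size_cat // drop_size_cat //=.
by rewrite take0 drop0 N_size2 M_size2.
Qed.

(** Induction on the length of [s2]: the prefix [s1] holds the entries already brought into bidegree
    (1, 1), and each use of [NM_step] moves one entry across. *)
Lemma NM_row1 s1 s2 : all_in (gr (1, 1)) s1 -> all_in row1 s2 ->
  (size s1 + size s2)%N = t -> N (s1 ++ s2) = M (s1 ++ s2).
Proof.
have [n] := ubnP (size s2); elim: n s1 s2 => // n IH s1 [|x s2] szn h1.
  by rewrite cats0 addn0 => _ sz; apply: NM_base.
move=> /all_in_cons[/row1_decomp[ys [s [hys ->]]] h2] sz.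
have h1H : all_in H s1 by apply: all_in_sub h1 => v /row1_gr11/row1_H.
have h2H : all_in H s2 by apply: all_in_sub h2; apply: row1_H.
have ysH yz : yz \in ys -> H (m [:: yz.1; yz.2]).
  by move=> /hys[gy [k gz]]; apply/row1_H/(row1_mulr gy gz).
have sumH : H (\sum_(yz <- ys) m [:: yz.1; yz.2]).
  by apply: subgroup_sum => //; apply: H_subgroup.
have H0 := H_subgroup.1.
rewrite -[s *: _]addr0 N_multilinear // M_multilinear //.
rewrite (multilinear0 H_subgroup N_multilinear) // (multilinear0 H_subgroup M_multilinear) //.
rewrite (multilinear_sum H_subgroup N_multilinear) //.
rewrite (multilinear_sum H_subgroup M_multilinear) //; congr (_ *: _ + _).
apply: eq_big_seq => yz /hys[gy [k gz]].
apply: (NM_step _ _ h1 h2 gy gz); last by rewrite -sz /= addnS.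
move=> v s' szs rv hs'; apply: IH => //.
- by rewrite /= szs; move: szn => /=.
- by rewrite -cats1; apply/all_in_cat; split=> // w; rewrite inE => /eqP ->.
- by apply/all_in_cons.
- by rewrite size_rcons /= szs -sz /= addnS.
Qed.

Lemma determined_H xs : size xs = t -> all_in H xs -> m' xs = m xs.
Proof.
move=> sz hxs; rewrite -N_sizet // -M_sizet //; apply/eqP; rewrite -subr_eq0; apply/eqP.
have fL : multilinear_on H (fun s => N s - M s).
  move=> s1 s2 a x y h1 h2 hx hy.
  by rewrite N_multilinear // M_multilinear // scalerBr opprD addrACA.
apply: (multilinear_ind H_subgroup (f := fun s => N s - M s) (n := t)
  (T := fun v => v = 0) fL homogeneous_H H_homogeneous) hxs => //.
  by split=> // x y -> ->; rewrite subrr.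
move=> ys szy hys; have [zs [zsqs gzs]] := homogeneous_word hys.
have szz := homs_size gzs.
(* Both operations vanish on words with a factor outside E^{[1]}, so only words in [row1] remain. *)
have [wE|wE] := EM (map fst zs = nseq t B1); last first.
  have [|-> ->] := NM_word0 _ zsqs wE (homs_piece gzs); last by rewrite subrr.
  by rewrite size_map szz.
rewrite -[ys]cat0s NM_row1 ?subrr // => x xys.
suff : all (pred1 B1) (map fst zs).
  elim: zs ys gzs xys {zsqs szz wE szy hys} => [|z zs IH] [|y ys] //= [gy gzs].
  rewrite inE => /predU1P[->|xys] /andP[/eqP z1 h]; last exact: IH gzs xys h.
  by exists z.2; rewrite -z1 -surjective_pairing.
by rewrite wE all_nseq /= orbT.
Qed.

End Determined.

End Pieces.

Local Close Scope ring_scope.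

Theorem theorem2p13 (K : fieldType) (A : gradedAlgebra K) (d : nat)
    (hd : (4 <= d)%N) (hA : bi_Koszul A d)
    (P : freeResolution A) (E : extSpace P) (m : seq E -> E)
    (hm : Ainf_Ext_structure m) (htr : truncated d m) :
  let gr := @ext_gr K A P E in
  let u := ext_unit E in
  let F := @piece_sum K A P E d Fpieces in
  let G := @piece_sum K A P E d Gpieces in
  let mF := only [:: 2; d] m in
  let mG := only [:: 2; d.+1] m in
  [/\ Ainf_subalgebra F (@whole E) (coh gr) u mF,
      Ainf_algebra F (coh gr) u mF,
      pure gr F mF, single d F mF
    & determined d Fpieces d m] /\
  [/\ Ainf_subalgebra G (@whole E) (coh gr) u mG,
      Ainf_algebra G (coh gr) u mG,
      pure gr G mG, single d.+1 G mG
    & determined d Gpieces d.+1 m].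
Proof.
have core q2 (hq2 : q2 = B2d \/ q2 = B2d1) :
    let H := @piece_sum K A P E d [:: B0; B1; q2] in
    let M := only [:: 2%N; piece_shift d q2] m in
    [/\ Ainf_subalgebra H (@whole E) (coh (@ext_gr K A P E)) (ext_unit E) M,
        Ainf_algebra H (coh (@ext_gr K A P E)) (ext_unit E) M,
        pure (@ext_gr K A P E) H M, single (piece_shift d q2) H M
      & determined d [:: B0; B1; q2] (piece_shift d q2) m].
  split.
  - exact: H_subalgebra.
  - exact: H_Ainf.
  - exact: H_pure.
  - exact: H_single.
  - by move=> m' N_Ainf _ m'0 m'1 xs;
      exact: (determined_H hd hA hm htr hq2 N_Ainf m'0 m'1).
by split; [apply: (core B2d); left | apply: (core B2d1); right].
Qed.
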